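(* Let $r \ge 4$ and $2 \le i \le r-2$. There is a constant $C$ depending only on $r$ and $i$ such that the following holds for every $t \in \mathbb{N}$. Suppose that $G \subseteq [t]^{(r)}$ maximises the Lagrangian among $r$-graphs with $|G|$ edges, that $G$ is left-compressed, and that every member of $[t]^{(r)} \setminus G$ contains $I := \{t-(i-1), \ldots, t\}$. Let $H \subseteq [t-i]^{(r-i)}$ be the $(r-i)$-graph with edge set $\{e \setminus I : e \in G,\ I \subseteq e\}$. Then \[ P_2(H) = (1 + \eta)\, P_2^{\max}(|H|,\, r-i,\, t-i) \quad\text{for some } \eta \text{ with } |\eta| \le C t^{-(i-1)}. \]
   Context: $[n]^{(k)}$ is the family of $k$-subsets of $[n]=\{1,\dots,n\}$; an $r$-graph is a finite family of $r$-subsets of $\mathbb{N}$. A weighting of $\mathbb{N}$ is $w:\mathbb{N}\to[0,\infty)$ with $\sum_x w(x)=1$; $w(G)=\sum_{e\in G}\prod_{x\in e}w(x)$; the Lagrangian is $\lambda(G)=\max_w w(G)$. Left-compressed: for $x<y$ and an $r$-set $F$, $C_{xy}(F)=(F\setminus\{y\})\cup\{x\}$ if $x\notin F$, $y\in F$, else $C_{xy}(F)=F$; $C_{xy}(\mathcal F)=\{C_{xy}(F):F\in\mathcal F\}\cup\{F\in\mathcal F: C_{xy}(F)\in\mathcal F\}$; $\mathcal F$ is left-compressed if $C_{xy}(\mathcal F)=\mathcal F$ for all $x<y$. For a hypergraph $H$, $P_2(H)=\sum_{x}d(x)^2$, where $d(x)$ is the number of edges of $H$ containing $x$. For integers $m,k,n$,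 $P_2^{\max}(m,k,n)=\max\{P_2(H'): H'\subseteq[n]^{(k)},\ |H'|=m\}$. *)

(* Defs.v *)
From HB Require Import structures.
From mathcomp Require Import all_boot all_order all_algebra.
From mathcomp Require Import finmap.
From mathcomp Require Import all_classical all_reals all_analysis.
Set Implicit Arguments. Unset Strict Implicit. Unset Printing Implicit Defensive.
Import Order.TTheory GRing.Theory Num.Theory numFieldNormedType.Exports.
Local Open Scope classical_set_scope.
Local Open Scope ring_scope.

Definition weighting (R : realType) (w : nat -> R) : Prop :=
  (forall x, 0 <= w x) /\ (series w @ \oo --> (1 : R)).

Local Open Scope fset_scope.

Definition hgraph := {fset {fset nat}}.

Definition is_rgraph (r : nat) (G : hgraph) : Prop :=
  forall e, e \in G -> #|` e| = r.

Definition in_range (n : nat) (e : {fset nat}) : Prop :=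
  forall x, x \in e -> (1 <= x <= n)%N.

Definition sub_box (n k : nat) (G : hgraph) : Prop :=
  forall e, e \in G -> #|` e| = k /\ in_range n e.

Definition wval (R : realType) (w : nat -> R) (G : hgraph) : R :=
  \sum_(e <- G) \prod_(x <- e) w x.

(* Lagrangian = max over weightings of w(G) (taken as the supremum,
   which is attained). *)
Definition lagrangian (R : realType) (G : hgraph) : R :=
  sup [set y : R | exists w, weighting w /\ y = wval w G].

Definition compr_set (x y : nat) (F : {fset nat}) : {fset nat} :=
  if (x \notin F) && (y \in F) then x |` (F `\ y) else F.

Definition compr (x y : nat) (G : hgraph) : hgraph :=
  [fset compr_set x y F | F in G] `|` [fset F in G | compr_set x y F \in G].

(* left-compressed: C_xy(G) = G for all 1 <= x < y (vertices are positive). *)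
Definition left_compressed (G : hgraph) : Prop :=
  forall x y : nat, (1 <= x)%N -> (x < y)%N -> compr x y G = G.

Definition deg (H : hgraph) (x : nat) : nat := #|` [fset e in H | x \in e]|.

Definition vertices (H : hgraph) : {fset nat} := \big[fsetU/fset0]_(e <- H) e.

Definition P2 (H : hgraph) : nat := (\sum_(x <- vertices H) (deg H x) ^ 2)%N.

Definition is_P2max (M m k n : nat) : Prop :=
  (exists H', sub_box n k H' /\ #|` H'| = m /\ P2 H' = M) /\
  (forall H', sub_box n k H' -> #|` H'| = m -> (P2 H' <= M)%N).

Definition topI (t i : nat) : {fset nat} := [fset x | x in iota (t - i).+1 i].

Definition link (G : hgraph) (I : {fset nat}) : hgraph :=
  [fset e `\` I | e in G & I `<=` e].

(* Main.v *)
(* Write k = r - i, n = t - i, let H be the link of I in G, H' a maximiser of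
   P_2 with |H'| = |H|, and G' the r-graph obtained from G by replacing H by H'.
   A weighting w of [t] gives w(G) = Psi + beta * w(H), where beta is the
   product of the weights on I and Psi does not depend on H. Fix the weights on
   I and write the others as a + eps with sum eps = 0. Then
     w(G) = base + g * <d_H - mean, eps> - (c/2) |eps|^2 + error,
   with g = beta * a^(k-1), c bounded between positive constants, and base, g, c
   the same for H and H'. Optimising over eps gives base + g^2 Q(H) / (2c),
   where Q(H) = P_2(H) - (k|H|)^2 / n, up to a relative error O(n * beta).
   Stability of the r-th elementary symmetric polynomial at the uniform
   weighting shows that near-optimal weightings have all weights O(1/t), whence
   n * beta = O(t^-(i-1)). Moreover beta stays away from 0, since otherwise w(G)
   would not exceed the Lagrangian of the complete r-graph on t - 1 vertices,
   which G beats. So if P_2(H') exceeded P_2(H) by more than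
   O(t^-(i-1)) P_2(H'), then G' would have a larger Lagrangian than G. No
   maximising weighting is needed: the gain is bounded below uniformly over the
   near-optimal ones. *)
Require Import Defs.
From HB Require Import structures.
From mathcomp Require Import all_boot all_order all_algebra.
From mathcomp Require Import finmap.
From mathcomp Require Import all_classical all_reals all_analysis.
From mathcomp Require Import ring lra zify.
Import Order.TTheory GRing.Theory Num.Theory numFieldNormedType.Exports.
Set Implicit Arguments. Unset Strict Implicit. Unset Printing Implicit Defensive.
Local Open Scope fset_scope.
Local Open Scope ring_scope.

(** * Elementary symmetric polynomials *)

(** Generating polynomial of the elementary symmetric polynomials e_m: its m-th coefficient is the
    weight of the complete m-graph on [s], and it is multiplicative when vertex lists are
    concatenated. *)
Definition esp (R : comNzRingType) (T : Type) (w : T -> R) (s : seq T) :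
  {poly R} := \prod_(x <- s) (1 + w x *: 'X).

Lemma esp_cons (R : comNzRingType) (T : Type) (w : T -> R) x s :
  esp w (x :: s) = (1 + w x *: 'X) * esp w s.
Proof. by rewrite /esp big_cons. Qed.

Lemma coef_mul_linear (R : comNzRingType) (a : R) (p : {poly R}) m :
  ((1 + a *: 'X) * p)`_m.+1 = p`_m.+1 + a * p`_m.
Proof. by rewrite mulrDl mul1r coefD -scalerAl coefZ coefXM. Qed.

Lemma coef_mul_linear0 (R : comNzRingType) (a : R) (p : {poly R}) :
  ((1 + a *: 'X) * p)`_0 = p`_0.
Proof. by rewrite mulrDl mul1r coefD -scalerAl coefZ coefXM /= mulr0 addr0. Qed.

Lemma coef_esp_cons (R : comNzRingType) (T : Type) (w : T -> R) x s m :
  (esp w (x :: s))`_m.+1 = (esp w s)`_m.+1 + w x * (esp w s)`_m.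
Proof. by rewrite esp_cons coef_mul_linear. Qed.

Lemma coef_esp0 (R : comNzRingType) (T : Type) (w : T -> R) s :
  (esp w s)`_0 = 1.
Proof.
elim: s => [|x s IH]; first by rewrite /esp big_nil coefC.
by rewrite esp_cons coef_mul_linear0.
Qed.

Lemma coef_esp_nil (R : comNzRingType) (T : Type) (w : T -> R) m :
  (esp w [::])`_m.+1 = 0.
Proof. by rewrite /esp big_nil coefC. Qed.

Lemma coef_esp1 (R : comNzRingType) (T : Type) (w : T -> R) s :
  (esp w s)`_1 = \sum_(x <- s) w x.
Proof.
elim: s => [|x s IH]; first by rewrite coef_esp_nil big_nil.
by rewrite coef_esp_cons IH coef_esp0 mulr1 big_cons addrC.
Qed.

Lemma coef_esp_big (R : comNzRingType) (T : Type) (w : T -> R) s m :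
  (size s < m)%N -> (esp w s)`_m = 0.
Proof.
elim: s m => [|x s IH] [|m] // Hm; first by rewrite coef_esp_nil.
by rewrite coef_esp_cons !IH ?mulr0 ?addr0 // ltnW.
Qed.

Lemma coef_esp_size (R : comNzRingType) (T : Type) (w : T -> R) s :
  (esp w s)`_(size s) = \prod_(x <- s) w x.
Proof.
elim: s => [|x s IH]; first by rewrite coef_esp0 big_nil.
by rewrite /= coef_esp_cons coef_esp_big // add0r IH big_cons.
Qed.

Lemma coef_esp_ge0 (R : realFieldType) (T : eqType) (w : T -> R) (s : seq T) m :
  (forall x, x \in s -> 0 <= w x) -> 0 <= (esp w s)`_m.
Proof.
elim: s m => [|x s IH] [|m] w0; rewrite ?coef_esp0 ?coef_esp_nil //.
rewrite coef_esp_cons addr_ge0 ?mulr_ge0 ?IH ?w0 ?mem_head // => y ys;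
  by rewrite w0 // in_cons ys orbT.
Qed.

Lemma esp_rem (R : comNzRingType) (T : eqType) (w : T -> R) x s :
  x \in s -> esp w s = (1 + w x *: 'X) * esp w (rem x s).
Proof. by move=> xs; rewrite /esp (big_rem x). Qed.

Lemma esp_rem_cons (R : comNzRingType) (T : eqType) (w : T -> R) x y s :
  y \in s -> esp w (rem y (x :: s)) = (1 + w x *: 'X) * esp w (rem y s).
Proof.
move=> ys /=; case: eqP => [->|_]; last by rewrite esp_cons.
exact: esp_rem.
Qed.

Lemma esp_deriv (R : comNzRingType) (T : eqType) (w : T -> R) s :
  (esp w s)^`() = \sum_(x <- s) w x *: esp w (rem x s).
Proof.
elim: s => [|x s IH]; first by rewrite /esp !big_nil derivC.
rewrite esp_cons derivM IH big_cons /= eqxx; congr (_ + _).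
  by rewrite derivD derivZ derivX derivC add0r -scalerAl mul1r.
rewrite mulr_sumr; apply: eq_big_seq => y ys.
by rewrite esp_rem_cons // scalerAr.
Qed.

(** Euler's identity for homogeneous polynomials, read off from the coefficients of the
    derivative. *)
Lemma coef_esp_euler (R : comNzRingType) (T : eqType) (w : T -> R) (s : seq T) m :
  m.+1%:R * (esp w s)`_m.+1 = \sum_(x <- s) w x * (esp w (rem x s))`_m.
Proof.
rewrite mulr_natl -coef_deriv esp_deriv coef_sum.
by apply: eq_bigr => x _; rewrite coefZ.
Qed.

(** * Maclaurin's inequality with a quadratic loss *)

(* [tangent_gap] is the amount by which the tangent at [z0] exceeds
   [(s - z) * z ^+ m]; the recursion below makes its sign visible. *)
Definition tangent_gap (R : realFieldType) (s z z0 : R) (m : nat) : R :=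
  m%:R * z0 ^+ m.-1 * (z - z0) ^+ 2
  - (s - z) * (z ^+ m - z0 ^+ m - m%:R * z0 ^+ m.-1 * (z - z0)).

Lemma tangent_gapE (R : realFieldType) (s z z0 : R) m :
  (s - z) * z ^+ m = (s - z0) * z0 ^+ m
    + (s * m%:R * z0 ^+ m.-1 - m.+1%:R * z0 ^+ m) * (z - z0)
    - tangent_gap s z z0 m.
Proof.
rewrite /tangent_gap; case: m => [|m] /=; first by rewrite !expr0; ring.
by rewrite !exprS -!natr1; ring.
Qed.

Lemma tangent_gapS (R : realFieldType) (s z z0 : R) m :
  tangent_gap s z z0 m.+2 = z * tangent_gap s z z0 m.+1
    + z0 ^+ m * (z - z0) ^+ 2 * (m.+2%:R * z0 - m.+1%:R * s).
Proof. by rewrite /tangent_gap /= !exprS -!natr1; ring. Qed.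

(** Induction through [tangent_gapS]. The point [s * (1 - 1/t)] is the value of [S - w x] at uniform
    weights; there the added term has the factor [s * (1 - (m+2)/t)], nonnegative as long as m+2 <=
    t. *)
Lemma tangent_gap_ge0 (R : realFieldType) (s z : R) t m :
  0 <= s -> 0 <= z -> (0 < t)%N -> (m <= t)%N ->
  0 <= tangent_gap s z (s * (1 - t%:R^-1)) m.
Proof.
move=> s0 z0 t0; have t0' : 0 < t%:R :> R by rewrite ltr0n.
have y0 : 0 <= s * (1 - t%:R^-1).
  by rewrite mulr_ge0 // subr_ge0 invf_le1 // ler1n.
elim: m => [|[|m] IH] mt.
- by rewrite /tangent_gap !expr0 /= !(mul0r, subrr, mulr0, subr0).
- rewrite /tangent_gap !expr1 expr0 !mul1r subrr mulr0 subr0; exact: sqr_ge0.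
- rewrite tangent_gapS; apply: addr_ge0; first by rewrite mulr_ge0 ?IH // ltnW.
  apply: mulr_ge0; first by rewrite mulr_ge0 ?sqr_ge0 ?exprn_ge0.
  have -> : m.+2%:R * (s * (1 - t%:R^-1)) - m.+1%:R * s =
    s * (1 - m.+2%:R / t%:R) by rewrite -!natr1; ring.
  by rewrite mulr_ge0 // subr_ge0 ler_pdivrMr // mul1r ler_nat.
Qed.

Lemma tangent_gap_ge (R : realFieldType) (s z : R) t m :
  0 <= s -> 0 <= z -> (0 < t)%N -> (m.+2 <= t)%N ->
  (s * (1 - t%:R^-1)) ^+ m * (s * (1 - m.+2%:R / t%:R))
    * (z - s * (1 - t%:R^-1)) ^+ 2
  <= tangent_gap s z (s * (1 - t%:R^-1)) m.+2.
Proof.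
move=> s0 z0 t0 mt; rewrite tangent_gapS.
have -> : m.+2%:R * (s * (1 - t%:R^-1)) - m.+1%:R * s =
    s * (1 - m.+2%:R / t%:R) by rewrite -!natr1; ring.
rewrite mulrAC ler_wpDl ?lexx // mulr_ge0 // tangent_gap_ge0 //.
exact: ltnW.
Qed.

Lemma sum_const_seq (R : pzRingType) (T : Type) (s : seq T) (c : R) :
  \sum_(x <- s) c = (size s)%:R * c.
Proof. by rewrite big_const_seq count_predT iter_addr_0 mulr_natl. Qed.

(** The tangent inequality is added over all vertices; its linear terms cancel because the
    deviations [S / t - w x] sum to zero. *)
Lemma sum_tangent_gap (R : realFieldType) (T : eqType) (w : T -> R) (s : seq T) m q :
  (0 < size s)%N ->
  let S := \sum_(x <- s) w x in
  let t := (size s)%:R : R in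
  (forall x, x \in s -> q * (w x - S / t) ^+ 2 <=
     tangent_gap S (S - w x) (S * (1 - t^-1)) m) ->
  \sum_(x <- s) w x * (S - w x) ^+ m <=
    S * (S * (1 - t^-1)) ^+ m - q * \sum_(x <- s) (w x - S / t) ^+ 2.
Proof.
move=> s0 S t gap; have t0 : t != 0 by rewrite pnatr_eq0 -lt0n.
set z0 := S * (1 - t^-1); set c := S * m%:R * z0 ^+ m.-1 - m.+1%:R * z0 ^+ m.
have H x : x \in s -> w x * (S - w x) ^+ m <=
    (S - z0) * z0 ^+ m + c * (S / t - w x) - q * (w x - S / t) ^+ 2.
  move=> xs; have := tangent_gapE S (S - w x) z0 m.
  rewrite opprB addrCA subrr addr0 => ->; rewrite -/c lerB ?gap //.
  by rewrite le_eqVlt; apply/orP; left; apply/eqP; rewrite /z0; ring.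
rewrite big_seq (le_trans (ler_sum _ H)) // -big_seq big_split /= sumrN.
rewrite -mulr_sumr lerD2r big_split /= sum_const_seq -mulr_sumr sumrB.
rewrite sum_const_seq -/t -/S le_eqVlt; apply/orP; left; apply/eqP.
by rewrite /z0; field.
Qed.

Lemma sum_rem (R : zmodType) (T : eqType) (w : T -> R) x s : x \in s ->
  \sum_(y <- rem x s) w y = \sum_(y <- s) w y - w x.
Proof. by move=> xs; rewrite [in RHS](big_rem x) //= addrAC subrr add0r. Qed.

(** Euler's identity reduces e_{m+1} to e_m on the list without x, of total weight [S - w x]; the
    bound on e_m then leaves the sum treated in [sum_tangent_gap]. The parameter [q] serves twice: q
    = 0 yields Maclaurin's inequality, q > 0 its stability. *)
Lemma coef_esp_le_step (R : realFieldType) (T : eqType) (w : T -> R) (s : seq T) m q :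
  (forall x, x \in s -> 0 <= w x) -> (m < size s)%N ->
  let S := \sum_(x <- s) w x in
  let t := (size s)%:R : R in
  (forall x, x \in s -> q * (w x - S / t) ^+ 2 <=
     tangent_gap S (S - w x) (S * (1 - t^-1)) m) ->
  (forall s' : seq T, (forall x, x \in s' -> 0 <= w x) -> (esp w s')`_m <=
    'C(size s', m)%:R * ((\sum_(x <- s') w x) / (size s')%:R) ^+ m) ->
  m.+1%:R * (esp w s)`_m.+1 <=
    m.+1%:R * ('C(size s, m.+1)%:R * (S / t) ^+ m.+1)
    - 'C((size s).-1, m)%:R / (size s).-1%:R ^+ m * q
      * \sum_(x <- s) (w x - S / t) ^+ 2.
Proof.
move=> w0 ms S t gap IH; have s0 : (0 < size s)%N by apply: leq_ltn_trans ms.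
set p := (size s).-1; set K : R := 'C(p, m)%:R / p%:R ^+ m.
have K0 : 0 <= K by rewrite divr_ge0 ?exprn_ge0 ?ler0n.
have t0 : t != 0 by rewrite pnatr_eq0 -lt0n.
rewrite coef_esp_euler.
have le1 : \sum_(x <- s) w x * (esp w (rem x s))`_m <=
    \sum_(x <- s) K * (w x * (S - w x) ^+ m).
  rewrite !big_seq; apply: ler_sum => x xs.
  rewrite mulrCA ler_wpM2l ?w0 //.
  have := IH (rem x s); rewrite size_rem // -/p sum_rem // -/S expr_div_n.
  by rewrite mulrCA mulrC /K -!mulrA; apply => y /mem_rem; apply: w0.
apply: (le_trans le1); rewrite -mulr_sumr.
have := sum_tangent_gap s0 gap; rewrite -/S -/t => le2.
apply: (le_trans (ler_wpM2l K0 le2)); rewrite mulrBr -!mulrA lerD2r.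
rewrite !mulrA -natrM -mul_bin_diag natrM -/t -/p.
have pt : t = p%:R + 1 by rewrite natr1 prednK.
(* For m = 0 the list may be a singleton, and then [p] is 0 and cannot be divided by. *)
case: m => [|m] in ms gap IH K K0 le1 le2 *.
  by rewrite /K !expr0 !bin0 expr1 le_eqVlt; apply/orP; left; apply/eqP; field.
have p0 : p%:R != 0 :> R.
  by rewrite pnatr_eq0 -lt0n -ltnS /p prednK //; apply: leq_trans ms.
have z0E : S * (1 - t^-1) = p%:R * (S / t) by rewrite pt; field; rewrite -pt.
rewrite z0E exprMn /K [(S / t) ^+ m.+2]exprS le_eqVlt; apply/orP; left.
apply/eqP.
set P := p%:R ^+ m.+1; set Q := (S / t) ^+ m.+1.
have P0 : P != 0 by rewrite expf_neq0.
by field; rewrite -/t t0 P0.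
Qed.

(** Maclaurin's inequality, by induction from [coef_esp_le_step] with q = 0. *)
Lemma coef_esp_max (R : realFieldType) (T : eqType) (w : T -> R) m s :
  (forall x, x \in s -> 0 <= w x) ->
  (esp w s)`_m <= 'C(size s, m)%:R * ((\sum_(x <- s) w x) / (size s)%:R) ^+ m.
Proof.
elim: m s => [|m IH] s w0; first by rewrite coef_esp0 expr0 bin0 mulr1.
have [ms|sm] := ltnP m (size s); last by rewrite coef_esp_big // bin_small // mul0r.
have s0 : (0 < size s)%N by apply: leq_ltn_trans ms.
have S0 : 0 <= \sum_(x <- s) w x by rewrite big_seq sumr_ge0.
have := @coef_esp_le_step R T w s m 0 w0 ms; rewrite /= !(mulr0, mul0r) subr0.
rewrite ler_pM2l ?ltr0n //; apply => // x xs; rewrite mul0r.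
apply: tangent_gap_ge0 => //; last exact: ltnW.
by rewrite (big_rem x) //= addrAC subrr add0r big_seq sumr_ge0 // => y /mem_rem /w0.
Qed.

Lemma bin_ge (R : realFieldType) N m : (m.*2 <= N)%N ->
  (N%:R / 2) ^+ m / m`!%:R <= 'C(N, m)%:R :> R.
Proof.
move=> mN; rewrite ler_pdivrMr ?ltr0n ?fact_gt0 // -natrM bin_ffact.
have H : forall l, (l <= m)%N -> (N%:R / 2) ^+ l <= (N ^_ l)%:R :> R.
  elim=> [|l IH] lm; first by rewrite expr0 ffactn0.
  rewrite exprSr ffactnSr natrM ler_pM ?IH ?exprn_ge0 ?divr_ge0 ?ler0n ?(ltnW lm) //.
  rewrite ler_pdivrMr ?ltr0n // -natrM ler_nat muln2 -mul2n.
  rewrite mulnBr !mul2n -addnn -addnBA ?leq_addr //.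
  by rewrite (leq_trans _ mN) // leq_double ltnW.
exact: H.
Qed.

(** The last induction step of Maclaurin's inequality, run with q > 0. The exponent r - 1 has to be
    at least 2 for [tangent_gap_ge] to apply. *)
Lemma coef_esp_stability (R : realFieldType) (r : nat) : (3 <= r)%N ->
  exists2 c : R, 0 < c & forall (T : eqType) (w : T -> R) (s : seq T),
    (r.*2 <= size s)%N -> (forall x, x \in s -> 0 <= w x) ->
    \sum_(x <- s) w x = 1 ->
    (esp w s)`_r <= 'C(size s, r)%:R / (size s)%:R ^+ r
       - c * \sum_(x <- s) (w x - (size s)%:R^-1) ^+ 2.
Proof.
case: r => [|[|[|m]]] // _.
(* [q] bounds [(1 - 1/t)^m * (1 - (m+2)/t)] from below, as both bases are at least 1/2 when 2r <= t;
   [k] bounds the binomial quotient of [coef_esp_le_step] through [bin_ge]. *)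
pose q : R := 2^-1 ^+ m.+1; pose k : R := 2^-1 ^+ m.+2 / m.+2`!%:R.
have q0 : 0 < q by rewrite exprn_gt0 // invr_gt0 ltr0n.
have k0 : 0 < k by rewrite divr_gt0 ?exprn_gt0 ?invr_gt0 ?ltr0n ?fact_gt0.
have kE : k = 2^-1 ^+ m.+2 / m.+2`!%:R by [].
clearbody k; exists (m.+3%:R^-1 * (k * q)) => [|T w s ms w0 S1].
  by rewrite mulr_gt0 ?invr_gt0 ?ltr0n // mulr_gt0.
have t6 : (m.+3 <= size s)%N by apply: leq_trans ms; rewrite -addnn leq_addr.
have s0 : (0 < size s)%N by apply: leq_trans t6.
have t0 : 0 < (size s)%:R :> R by rewrite ltr0n.
have := @coef_esp_le_step R T w s m.+2 q w0 t6; rewrite /= S1 !div1r.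
move=> H; rewrite -(@ler_pM2l _ m.+3%:R) ?ltr0n // [leRHS]mulrBr.
have {}H := H _ (fun s' => @coef_esp_max R T w _ s').
rewrite -exprVn; apply: le_trans (H _) _ => [x xs|].
  rewrite !mul1r; have := @tangent_gap_ge R 1 (1 - w x) (size s) m.
  rewrite !mul1r => /(_ ler01) gap; apply: le_trans (gap _ s0 (ltnW t6)).
    have -> : (1 - w x - (1 - (size s)%:R^-1)) ^+ 2 = (w x - (size s)%:R^-1) ^+ 2.
      by ring.
    rewrite ler_wpM2r ?sqr_ge0 // /q exprSr ler_pM ?exprn_ge0 ?invr_ge0 ?ler0n //.
      rewrite lerXn2r ?nnegrE ?invr_ge0 ?ler0n // ?subr_ge0 ?invf_le1 ?ler1n //.
      have : (size s)%:R^-1 <= 2^-1 :> R.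
        by rewrite lef_pV2 ?posrE ?ltr0n // ler_nat (leq_trans _ t6).
      by lra.
    have : m.+2%:R / (size s)%:R <= 2^-1 :> R.
      rewrite ler_pdivrMr // mulrC ler_pdivlMr ?ltr0n // -natrM ler_nat muln2.
      by rewrite (leq_trans _ ms) // leq_double.
    by lra.
  by rewrite subr_ge0 -S1 (big_rem x) //= lerDl big_seq sumr_ge0 // => y /mem_rem /w0.
rewrite lerD2l lerN2 !mulrA divff ?pnatr_eq0 // mul1r -!mulrA !mulrA.
rewrite ler_wpM2r ?sumr_ge0 // => [x _|]; first exact: sqr_ge0.
rewrite ler_wpM2r ?exprn_ge0 ?invr_ge0 ?ler0n //.
have p0 : 0 < (size s).-1%:R :> R.
  by rewrite ltr0n -ltnS prednK // (leq_trans _ t6).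
rewrite ler_pdivlMr ?exprn_gt0 // kE mulrAC -exprMn [2^-1 * _]mulrC.
apply: bin_ge; rewrite -ltnS prednK //.
by rewrite (leq_trans _ ms) // -(ltn_predK ms) ltnS ltn_double.
Qed.

(** * Perturbation around constant weights *)

(** Each factor is [(1 + a X) + eps x X]; taking the second summand at j vertices gives e_j of [eps]
    and leaves size s - j factors [1 + a X]. For j > size s the truncated exponent is harmless,
    since e_j is 0. The factor [P] lets the induction absorb one vertex and later holds the top
    vertices. *)
Lemma coef_esp_shift (R : comNzRingType) (T : Type) (eps : T -> R) (a : R)
    (P : {poly R}) s r :
  (P * esp (fun x => a + eps x) s)`_r =
    \sum_(j < r.+1) (esp eps s)`_j
      * (P * (1 + a *: 'X) ^+ (size s - j))`_(r - j).
Proof.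
elim: s P => [|x s IH] P.
  rewrite big_ord_recl coef_esp0 mul1r /= !subn0 expr0.
  rewrite [X in _ + X]big1 => [|j _]; first by rewrite addr0 /esp big_nil.
  by rewrite /bump /= add1n coef_esp_nil mul0r.
rewrite esp_cons scalerDl addrA mulrA mulrDr mulrDl coefD IH.
have -> : (P * (eps x *: 'X) * esp (fun x0 => a + eps x0) s)`_r =
    eps x * (P * 'X * esp (fun x0 => a + eps x0) s)`_r.
  by rewrite -scalerAr -scalerAl coefZ.
rewrite IH big_ord_recl coef_esp0 [in RHS]big_ord_recl coef_esp0 /=.
rewrite [X in _ + _ * X]big_ord_recr /= subnn.
have -> : (P * 'X * (1 + a *: 'X) ^+ (size s - r))`_0 = 0.
  by rewrite mulrAC coefMX eqxx.
rewrite mulr0 addr0 !subn0 -mulrA -exprS.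
rewrite -addrA; congr (_ + _); rewrite mulr_sumr -big_split /=.
apply: eq_bigr => j _; rewrite coef_esp_cons /bump /= add1n subSS.
rewrite mulrDl; congr (_ + _).
  have [js|sj] := ltnP j (size s); last by rewrite coef_esp_big ?mul0r // ltnS.
  by rewrite -mulrA -exprS -subSn.
by rewrite mulrAC coefMX subn_eq0 leqNgt ltn_ord /= mulrA subnS.
Qed.

Lemma coef_esp_le_pow (R : realFieldType) (T : eqType) (w : T -> R) m s :
  (forall x, x \in s -> 0 <= w x) -> (esp w s)`_m <= (\sum_(x <- s) w x) ^+ m.
Proof.
elim: s m => [|x s IH] [|m] w0; rewrite ?coef_esp0 ?expr0 //.
  by rewrite coef_esp_nil big_nil expr0n.
have w0' y : y \in s -> 0 <= w y by move=> ys; rewrite w0 // in_cons ys orbT.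
have x0 : 0 <= w x by rewrite w0 ?mem_head.
have S0 : 0 <= \sum_(y <- s) w y by rewrite big_seq sumr_ge0.
rewrite coef_esp_cons big_cons; set S := \sum_(y <- s) w y in S0 *.
apply: (@le_trans _ _ ((w x + S) * S ^+ m)).
  by rewrite mulrDl addrC lerD ?ler_wpM2l ?IH // -exprS IH.
rewrite exprS ler_wpM2l ?addr_ge0 // lerXn2r ?nnegrE ?addr_ge0 //.
by rewrite lerDr.
Qed.

Lemma coef_esp_rem (R : comNzRingType) (T : eqType) (w : T -> R) x s m :
  x \in s ->
  (esp w s)`_m.+1 = (esp w (rem x s))`_m.+1 + w x * (esp w (rem x s))`_m.
Proof. by move=> xs; rewrite (esp_rem _ xs) coef_mul_linear. Qed.

(** Putting x back into the list trades one degree of the symmetric polynomial for one more power of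
    [w x], as in Newton's identities. *)
Lemma newton_step (R : comNzRingType) (T : eqType) (w : T -> R) s j l :
  \sum_(x <- s) w x ^+ l * (esp w (rem x s))`_j.+1 =
  (\sum_(x <- s) w x ^+ l) * (esp w s)`_j.+1
  - \sum_(x <- s) w x ^+ l.+1 * (esp w (rem x s))`_j.
Proof.
rewrite mulr_suml -sumrB; apply: eq_big_seq => x xs.
by rewrite (coef_esp_rem _ _ xs) exprSr; ring.
Qed.

Lemma coef_esp_newton (R : comNzRingType) (T : eqType) (w : T -> R) j s :
  \sum_(x <- s) w x = 0 ->
  j.+2%:R * (esp w s)`_j.+2 =
    - \sum_(x <- s) w x ^+ 2 * (esp w (rem x s))`_j.
Proof.
move=> S0; rewrite coef_esp_euler.
have := newton_step w s j 1; under eq_bigr do rewrite expr1.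
by move=> ->; under eq_bigr do rewrite expr1; rewrite S0 mul0r sub0r.
Qed.

Lemma coef_esp2 (R : realFieldType) (T : eqType) (w : T -> R) s :
  \sum_(x <- s) w x = 0 ->
  (esp w s)`_2 = - (\sum_(x <- s) w x ^+ 2) / 2.
Proof.
move=> /(coef_esp_newton 0); under eq_bigr do rewrite coef_esp0 mulr1.
by move=> <-; field.
Qed.

Lemma sqr_le_sum_sqr (R : realFieldType) (T : eqType) (w : T -> R) s x :
  x \in s -> w x ^+ 2 <= \sum_(y <- s) w y ^+ 2.
Proof.
move=> xs; rewrite (big_rem x) //= lerDl sumr_ge0 // => y _; exact: sqr_ge0.
Qed.

Lemma power_sum_le (R : realFieldType) (T : eqType) (w : T -> R) s (N : R) l :
  0 <= N -> \sum_(x <- s) w x ^+ 2 = N ^+ 2 ->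
  `|\sum_(x <- s) w x ^+ l.+2| <= N ^+ l.+2.
Proof.
move=> N0 SN; apply: (le_trans (ler_norm_sum _ _ _)).
rewrite -addn2 exprD -SN mulr_sumr !big_seq ler_sum // => x xs.
rewrite exprD normrM [ `|w x ^+ 2|]ger0_norm ?sqr_ge0 // ler_wpM2r ?sqr_ge0 //.
rewrite normrX lerXn2r ?nnegrE // -(@ler_pXn2r _ 2) ?nnegrE //.
by rewrite real_normK ?num_real // -SN sqr_le_sum_sqr.
Qed.

(** A bound through the sum of the [|w x|] would lose powers of the square root of the number of
    vertices; Newton's identities keep the Euclidean norm. *)
Lemma coef_esp_le_norm (R : realFieldType) (T : eqType) (w : T -> R) s (N : R) j :
  0 <= N -> \sum_(x <- s) w x = 0 -> \sum_(x <- s) w x ^+ 2 = N ^+ 2 ->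
  `|(esp w s)`_j| <= N ^+ j.
Proof.
move=> N0 S0 SN.
(* Joint induction with power sums weighted by the symmetric polynomials of the other vertices.
   Their factor m+1 is absorbed by the factor m+2 in [coef_esp_newton]. *)
have H m : `|(esp w s)`_m.+1| <= N ^+ m.+1 /\ forall l,
    `|\sum_(x <- s) w x ^+ l.+2 * (esp w (rem x s))`_m|
      <= m.+1%:R * N ^+ (m + l.+2).
  elim: m => [|m [IHe IHT]]; split.
  - by rewrite coef_esp1 S0 normr0 expr1.
  - move=> l; under eq_bigr do rewrite coef_esp0 mulr1.
    by rewrite mul1r add0n power_sum_le.
  - rewrite -(@ler_pM2l _ m.+2%:R) ?ltr0n // -{1}[m.+2%:R]normr_nat -normrM.
    rewrite coef_esp_newton // normrN; apply: (le_trans (IHT 0)).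
    by rewrite addn2 ler_wpM2r ?exprn_ge0 // ler_nat.
  - move=> l; rewrite newton_step; apply: (le_trans (ler_normB _ _)).
    rewrite -[m.+2%:R]natr1 addrC mulrDl mul1r lerD //.
      by rewrite addSnnS IHT.
    by rewrite normrM addnC exprD ler_pM ?power_sum_le.
by case: j => [|j]; [rewrite coef_esp0 normr1 | case: (H j)].
Qed.

(** The explicit part consists of the terms j = 0, 1, 2 of [coef_esp_shift], where e_1 = 0 and e_2 =
    -N^2/2. Each of the r remaining terms is at most [E * N ^+ 3], as N <= 1. *)
Lemma esp_perturb (R : realFieldType) (T : eqType) (P : {poly R})
    (eps : T -> R) s (a : R) r (N E : R) :
  0 <= N -> N <= 1 ->
  \sum_(x <- s) eps x = 0 -> \sum_(x <- s) eps x ^+ 2 = N ^+ 2 ->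
  (forall j, (j <= r.+2)%N ->
    `|(P * (1 + a *: 'X) ^+ (size s - j))`_(r.+2 - j)| <= E) ->
  `|(P * esp (fun x => a + eps x) s)`_r.+2
    - ((P * (1 + a *: 'X) ^+ size s)`_r.+2
       - (P * (1 + a *: 'X) ^+ (size s - 2))`_r / 2 * N ^+ 2)|
  <= r%:R * E * N ^+ 3.
Proof.
move=> N0 N1 S0 SN cE; rewrite coef_esp_shift !big_ord_recl /= /bump /=.
rewrite coef_esp0 !add1n coef_esp1 S0 coef_esp2 // SN !subSS !subn0.
set A := (P * (1 + a *: 'X) ^+ size s)`_r.+2; set B := (P * _)`_r.
set X := \sum_(i < r) _.
have -> : 1 * A + (0 * (P * (1 + a *: 'X) ^+ (size s - 1))`_r.+1
    + (- N ^+ 2 / 2 * B + X)) - (A - B / 2 * N ^+ 2) = X by ring.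
apply: (le_trans (ler_norm_sum _ _ _)).
rewrite -mulrA mulr_natl -[X in _ *+ X]card_ord -sumr_const; apply: ler_sum => j _.
rewrite normrM mulrC ler_pM ?cE //; first by rewrite !add1n !ltnS.
apply: (le_trans (coef_esp_le_norm _ N0 S0 SN)).
by rewrite -[(1 + _)%N]/(3 + j)%N exprD ler_piMr ?exprn_ge0 // exprn_ile1.
Qed.

Lemma coef_le_horner1 (R : realFieldType) (p : {poly R}) m :
  (forall j, 0 <= p`_j) -> p`_m <= p.[1].
Proof.
move=> p0; rewrite horner_coef.
have [ms|sm] := ltnP m (size p).
  rewrite (bigD1 (Ordinal ms)) //= expr1n mulr1 lerDl sumr_ge0 // => j _.
  by rewrite expr1n mulr1.
by rewrite nth_default // sumr_ge0 // => j _; rewrite expr1n mulr1.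
Qed.

Lemma coef_mul_ge0 (R : realFieldType) (p q : {poly R}) m :
  (forall j, 0 <= p`_j) -> (forall j, 0 <= q`_j) -> 0 <= (p * q)`_m.
Proof. by move=> p0 q0; rewrite coefM sumr_ge0 // => j _; rewrite mulr_ge0. Qed.

Lemma coef_linear_exp (R : realFieldType) (a : R) n m :
  ((1 + a *: 'X) ^+ n)`_m = 'C(n, m)%:R * a ^+ m.
Proof.
elim: n m => [|n IH] [|m]; rewrite ?expr0 ?coefC //=.
- by rewrite bin0 mul1r.
- by rewrite mul0r.
- by rewrite exprS coef_mul_linear0 IH !bin0.
- by rewrite exprS coef_mul_linear !IH binS natrD exprS; ring.
Qed.

(** * Families of k-subsets and links *)

(** The recursion is Pascal's rule, the same as in [coef_esp_cons], so that sums over a complete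
    m-graph become coefficients of [esp]. *)
Fixpoint ksub (s : seq nat) (m : nat) : seq {fset nat} :=
  match s with
  | [::] => if m is 0 then [:: fset0] else [::]
  | x :: s' => if m is m'.+1 then ksub s' m ++ [seq x |` e | e <- ksub s' m']
               else [:: fset0]
  end.

Lemma ksub0 s : ksub s 0 = [:: fset0]. Proof. by case: s. Qed.

Lemma ksubS x s m :
  ksub (x :: s) m.+1 = ksub s m.+1 ++ [seq x |` e | e <- ksub s m].
Proof. by []. Qed.

Lemma mem_ksub s m (e : {fset nat}) : uniq s ->
  e \in ksub s m <-> {subset e <= s} /\ #|` e| = m.
Proof.
elim: s m e => [|x s IH] [|m] e //= us.
- rewrite inE; split=> [/eqP->|[_ /cardfs0_eq->]] //; split=> [y|]; by rewrite ?inE ?cardfs0.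
- split=> // -[sub]; case: (fset_0Vmem e) => [->|[y /sub]]; by rewrite ?cardfs0.
- rewrite inE; split=> [/eqP->|[_ /cardfs0_eq->]] //; split=> [y|]; by rewrite ?inE ?cardfs0.
have /andP[xs us'] := us.
rewrite mem_cat; split.
  case/orP=> [/(IH _ _ us') [sub c]|/mapP[f /(IH _ _ us') [sub c] ->]].
    by split=> // y /sub ys; rewrite in_cons ys orbT.
  have xf : x \notin f by apply: contra xs => /sub.
  split; last by rewrite cardfsU1 xf c.
  by move=> y; rewrite !inE => /orP[->|/sub ->]; rewrite ?orbT.
case=> sub c; have [xe|xe] := boolP (x \in e); apply/orP; [right|left].
  apply/mapP; exists (e `\ x); last by rewrite fsetD1K.
  apply/(IH _ _ us'); split=> [y|].
    by rewrite !inE => /andP[yx /sub]; rewrite in_cons (negbTE yx).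
  by have := cardfsD1 x e; rewrite xe c => -[].
apply/(IH _ _ us'); split=> // y ye; have := sub y ye.
by rewrite in_cons => /orP[/eqP yx|//]; rewrite -yx ye in xe.
Qed.

Lemma ksub_notin x s m (e : {fset nat}) : uniq (x :: s) -> e \in ksub s m -> x \notin e.
Proof. by case/andP=> xs us /(mem_ksub _ _ us) [sub _]; apply: contra xs => /sub. Qed.

Lemma ksub_uniq s m : uniq s -> uniq (ksub s m).
Proof.
elim: s m => [|x s IH] [|m] // us; have /andP[xs us'] := us.
rewrite ksubS cat_uniq IH //= map_inj_in_uniq ?IH // => [|e f es fs].
  rewrite andbT; apply/hasPn => f /mapP[e es ->]; apply/negP => /(ksub_notin us).
  by rewrite !inE eqxx.
have xe := ksub_notin us es; have xf := ksub_notin us fs.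
by move=> /(congr1 (fun A => A `\ x)); rewrite !fsetU1K.
Qed.

Lemma sum_ksub_prod (R : comNzRingType) (w : nat -> R) s m : uniq s ->
  \sum_(e <- ksub s m) \prod_(x <- e) w x = (esp w s)`_m.
Proof.
elim: s m => [|x s IH] [|m] us; rewrite ?ksub0 ?big_seq1 ?coef_esp0 ?big_seq_fset0 //.
  by rewrite coef_esp_nil ?big_nil.
have /andP[_ us'] := us.
rewrite ksubS big_cat big_map /= coef_esp_cons -!IH // mulr_sumr.
congr (_ + _); apply: eq_big_seq => e /(ksub_notin us) xe.
by rewrite big_fsetU1.
Qed.

Lemma sum_ksub_const (R : comNzRingType) (c : R) s m : uniq s ->
  \sum_(e <- ksub s m) c = 'C(size s, m)%:R * c.
Proof.
elim: s m => [|x s IH] [|m] us; rewrite ?ksub0 ?big_seq1 ?bin0 ?mul1r //.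
  by rewrite ?big_nil bin0n mul0r.
have /andP[_ us'] := us.
by rewrite ksubS big_cat big_map /= !IH // binS natrD mulrDl.
Qed.

(** Double counting: a vertex lies in C(n-1, m) of the (m+1)-subsets of an n-set. *)
Lemma sum_ksub_sum (R : comNzRingType) (y : nat -> R) s m : uniq s ->
  \sum_(e <- ksub s m.+1) \sum_(x <- e) y x =
    (\sum_(x <- s) y x) * 'C((size s).-1, m)%:R.
Proof.
elim: s m => [|x s IH] m us; first by rewrite !big_nil mul0r.
have /andP[_ us'] := us; rewrite ksubS big_cat big_map /= IH // big_cons.
rewrite (@eq_big_seq _ _ _ _ (ksub s m) _ (fun e => y x + \sum_(z <- e) y z));
  last by move=> e /(ksub_notin us) xe; rewrite big_fsetU1.
rewrite big_split /= sum_ksub_const //.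
case: m => [|m]; first by rewrite ksub0 big_seq1 big_seq_fset0 !bin0; ring.
rewrite IH //; case: s {IH us us'} => [|z s]; first by rewrite !big_nil; ring.
by rewrite /= binS natrD; ring.
Qed.

Lemma sum_fset_ksub (R : realFieldType) (f : {fset nat} -> R) (H : hgraph) s m :
  uniq s -> {subset H <= ksub s m} -> (forall e, e \in ksub s m -> 0 <= f e) ->
  \sum_(e <- H) f e <= \sum_(e <- ksub s m) f e.
Proof.
move=> us sub f0; rewrite [leRHS](bigID (fun e => e \in H)) /=.
rewrite -[X in _ <= X + _]big_filter.
rewrite (perm_big [seq e <- ksub s m | e \in H]) /=; last first.
  apply: uniq_perm; rewrite ?filter_uniq ?ksub_uniq ?fset_uniq // => e.
  rewrite mem_filter; case: (boolP (e \in H)) => // /sub ->; by [].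
by rewrite lerDl big_seq_cond sumr_ge0 // => e /andP[/f0].
Qed.

(** * First-order expansion of the weight of a hypergraph *)

(** Beyond first order the product is a polynomial in the [eps x] with nonnegative coefficients, so
    its value at the absolute values dominates it. *)
Lemma prod_shift_bound (R : realFieldType) (T : eqType) (eps : T -> R) (a : R) s :
  0 <= a ->
  `|\prod_(x <- s) (a + eps x) - a ^+ size s - a ^+ (size s).-1 * \sum_(x <- s) eps x|
  <= \prod_(x <- s) (a + `|eps x|) - a ^+ size s
     - a ^+ (size s).-1 * \sum_(x <- s) `|eps x|.
Proof.
move=> a0; elim: s => [|x s IH]; first by rewrite !big_nil !mulr0 !subr0 subrr normr0.
rewrite !big_cons /=.
(* On the empty list [(size s).-1] is 0 and the power does not split; the linear sum [S] is 0
   there. *)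
have aS (S : R) : (s = [::] -> S = 0) -> a ^+ size s * S = a * (a ^+ (size s).-1 * S).
  by case: (s) => [-> //|z s' _]; rewrite ?mulr0 // exprS mulrA.
have E (y p S : R) : (s = [::] -> S = 0) ->
  (a + y) * p - a ^+ (size s).+1 - a ^+ size s * (y + S) =
  (a + y) * (p - a ^+ size s - a ^+ (size s).-1 * S) + y * (a ^+ (size s).-1 * S).
  by move=> /aS; rewrite mulrDr exprS => ->; ring.
rewrite !E; try by move=> ->; rewrite big_nil.
apply: (le_trans (ler_normD _ _)); rewrite lerD // normrM.
  rewrite ler_pM // (le_trans (ler_normD _ _)) // ger0_norm //.
rewrite ler_wpM2l // normrM ger0_norm ?exprn_ge0 // ler_wpM2l ?exprn_ge0 //.
exact: ler_norm_sum.
Qed.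

(** The remainder of each edge is dominated by a nonnegative quantity, so H may be enlarged to all
    (k+2)-subsets; their remainder is governed by a coefficient of [esp] and expands by
    [coef_esp_shift]. *)
Lemma wval_shift (R : realType) (H : hgraph) (eps : nat -> R) (a : R) s k (E : R) :
  uniq s -> {subset H <= ksub s k.+2} -> 0 <= a ->
  \sum_(x <- s) `|eps x| <= 1 ->
  (forall j, (j <= k.+2)%N ->
     `|(1 * (1 + a *: 'X) ^+ (size s - j) : {poly R})`_(k.+2 - j)| <= E) ->
  `|wval (fun x => a + eps x) H - #|` H|%:R * a ^+ k.+2
     - a ^+ k.+1 * \sum_(e <- H) \sum_(x <- e) eps x|
  <= k.+1%:R * E * (\sum_(x <- s) `|eps x|) ^+ 2.
Proof.
move=> us sub a0 S1 cE; set S := \sum_(x <- s) _ in S1 *.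
have S0 : 0 <= S by apply: sumr_ge0.
pose f (e : {fset nat}) : R := \prod_(x <- e) (a + `|eps x|) - a ^+ k.+2
     - a ^+ k.+1 * \sum_(x <- e) `|eps x|.
have ce (e : {fset nat}) : e \in ksub s k.+2 -> size e = k.+2.
  by move=> /(mem_ksub _ _ us) [_].
have fE (e : {fset nat}) : e \in ksub s k.+2 ->
  `|\prod_(x <- e) (a + eps x) - a ^+ k.+2 - a ^+ k.+1 * \sum_(x <- e) eps x| <= f e.
  by move=> /ce es; have := prod_shift_bound eps e a0; rewrite es.
have f0 e : e \in ksub s k.+2 -> 0 <= f e by move=> /fE; apply: le_trans.
apply: (@le_trans _ _ (\sum_(e <- H) f e)).
  have -> : wval (fun x => a + eps x) H - #|` H|%:R * a ^+ k.+2
     - a ^+ k.+1 * \sum_(e <- H) \sum_(x <- e) eps x =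
    \sum_(e <- H) (\prod_(x <- e) (a + eps x) - a ^+ k.+2
       - a ^+ k.+1 * \sum_(x <- e) eps x).
    by rewrite mulr_sumr !sumrB sum_const_seq.
  apply: (le_trans (ler_norm_sum _ _ _)); rewrite !big_seq ler_sum // => e /sub.
  exact: fE.
apply: (le_trans (sum_fset_ksub us sub f0)).
rewrite /f !sumrB sum_ksub_const // -mulr_sumr sum_ksub_sum // -/S.
rewrite (sum_ksub_prod (fun x => a + `|eps x|)) //.
rewrite -[esp _ _]mul1r coef_esp_shift 2!big_ord_recl /= /bump /=.
rewrite coef_esp0 !add1n coef_esp1 -/S !subn0 !subSS !subn0 !mul1r.
rewrite !coef_linear_exp subn1.
set A := _%:R * _; set B := _%:R * _ ^+ k.+1; set X := \sum_(i < k.+1) _.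
(* The constant and linear terms of the expansion cancel against the subtracted ones; only j >= 2
   survives. *)
have -> : A + (S * B + X) - A - a ^+ k.+1 * (S * 'C((size s).-1, k.+1)%:R) = X.
  by rewrite /B; ring.
have -> : k.+1%:R * E * S ^+ 2 = \sum_(i < k.+1) E * S ^+ 2.
  by rewrite sumr_const card_ord -mulrA mulr_natl.
apply: ler_sum => j _.
have c0 m : 0 <= (1 * (1 + a *: 'X) ^+ (size s - m) : {poly R})`_(k.+2 - m).
  by rewrite mul1r coef_linear_exp mulr_ge0 ?ler0n ?exprn_ge0.
have eps0 x : x \in s -> 0 <= `|eps x| by [].
rewrite mulrC ler_pM ?c0 ?coef_esp_ge0 //.
  by apply: (le_trans (ler_norm _)); apply: cE; have := ltn_ord j; lia.
apply: (le_trans (coef_esp_le_pow _ eps0)); rewrite -/S.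
by rewrite -[(1 + _)%N]/(2 + j)%N exprD ler_piMr ?exprn_ge0 // exprn_ile1.
Qed.

Lemma big_fset_seq (R : nmodType) (F : nat -> R) (A : {fset nat}) (s : seq nat) :
  uniq s -> {subset A <= s} ->
  \sum_(x <- A) F x = \sum_(x <- s | x \in A) F x.
Proof.
move=> us sub; rewrite -[RHS]big_filter; apply: perm_big; apply: uniq_perm.
- exact: fset_uniq.
- exact: filter_uniq.
- by move=> x; rewrite mem_filter; case: (boolP (x \in A)) => // /sub ->.
Qed.

Lemma deg_sum (R : pzRingType) (H : hgraph) x (c : R) :
  \sum_(e <- H | x \in e) c = (deg H x)%:R * c.
Proof.
rewrite -big_filter sum_const_seq; congr (_%:R * _).
apply: perm_size; apply: uniq_perm.
- by rewrite filter_uniq ?fset_uniq.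
- exact: fset_uniq.
- by move=> e; rewrite mem_filter !inE andbC.
Qed.

Lemma sum_deg (R : pzRingType) (f : nat -> R) (H : hgraph) s : uniq s ->
  (forall e, e \in H -> {subset e <= s}) ->
  \sum_(e <- H) \sum_(x <- e) f x = \sum_(x <- s) (deg H x)%:R * f x.
Proof.
move=> us sub; transitivity (\sum_(e <- H) \sum_(x <- s | x \in e) f x).
  by apply: eq_big_seq => e /sub es; exact: big_fset_seq.
rewrite (exchange_big_dep predT) //=; apply: eq_bigr => x _; exact: deg_sum.
Qed.

Lemma P2E (R : pzRingType) (H : hgraph) s : uniq s ->
  (forall e, e \in H -> {subset e <= s}) ->
  (P2 H)%:R = \sum_(x <- s) (deg H x)%:R ^+ 2 :> R.
Proof.
move=> us sub; rewrite /P2 natr_sum.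
rewrite (@big_fset_seq _ _ _ s us) => [|x /bigfcupP [e]]; last first.
  by rewrite andbT => /sub; apply.
rewrite [RHS](bigID (fun x => x \in vertices H)) /= [X in _ + X]big1 => [|x xV].
  by rewrite addr0; apply: eq_bigr => x _; rewrite natrX.
suff -> : deg H x = 0%N by rewrite expr0n.
apply/eqP; rewrite /deg cardfs_eq0; apply/eqP/fsetP => e; rewrite !inE.
apply/negP => /andP[eH xe]; case/negP: xV; apply/bigfcupP; exists e => //.
by rewrite eH.
Qed.

Lemma bin_le_exp n m : ('C(n, m) <= n ^ m)%N.
Proof.
rewrite (@leq_trans (n ^_ m)) //.
  by rewrite -bin_ffact leq_pmulr ?fact_gt0.
elim: m => [|m IH]; first by rewrite ffactn0.
by rewrite ffactnSr expnSr leq_mul ?IH ?leq_subr.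
Qed.

(** The indicator of x, summed over all vertices of all edges, gives the degree; summed over all
    (k+1)-subsets it gives C(n-1, k) by [sum_ksub_sum]. *)
Lemma deg_le (H : hgraph) s k x : uniq s -> {subset H <= ksub s k.+1} ->
  (deg H x <= (size s) ^ k)%N.
Proof.
move=> us sub; pose R : realFieldType := rat.
have subs e : e \in H -> {subset e <= s} by move=> /sub /(mem_ksub _ _ us) [].
have [xs|xs] := boolP (x \in s); last first.
  suff -> : deg H x = 0%N by [].
  apply/eqP; rewrite /deg cardfs_eq0; apply/eqP/fsetP => e; rewrite !inE.
  by apply/negP => /andP[/subs se /se]; apply/negP.
rewrite (@leq_trans 'C((size s).-1, k)) //; last first.
  by rewrite (leq_trans (bin_le_exp _ _)) //; case: (k) => [|l]; rewrite ?expn0 ?leq_exp2r ?leq_pred.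
pose y z : R := (z == x)%:R.
have sy (t : seq nat) : x \in t -> uniq t -> \sum_(z <- t) y z = 1.
  move=> xt ut; rewrite (big_rem x) //= /y eqxx big_seq big1 ?addr0 // => z.
  by rewrite mem_rem_uniq // inE => /andP[/negbTE ->].
have sy0 (t : seq nat) : 0 <= \sum_(z <- t) y z.
  by rewrite sumr_ge0 // => z _; rewrite ler0n.
rewrite -(ler_nat R).
have -> : (deg H x)%:R = \sum_(e <- H | x \in e) 1 :> R by rewrite deg_sum mulr1.
have -> : 'C((size s).-1, k)%:R = \sum_(e <- ksub s k.+1) \sum_(z <- e) y z.
  by rewrite sum_ksub_sum // sy // mul1r.
apply: le_trans (sum_fset_ksub us sub _) => [|e _//].
rewrite big_mkcond ler_sum // => e _; case: ifP => // xe.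
by rewrite sy ?fset_uniq.
Qed.

(** * Exchanging the link of the top vertices *)

(** Inverse of [link] on the graphs whose missing sets all contain I. It allows H to be exchanged
    for H' while every other edge stays. *)
Definition unlink (t i r : nat) (H : hgraph) : hgraph :=
  [fset e in ksub (iota 1 t) r] `\`
  [fset g `|` topI t i | g in ksub (iota 1 (t - i)) (r - i) & g \notin H].

Lemma in_topI t i x : (x \in topI t i) = (x \in iota (t - i).+1 i).
Proof. by rewrite in_fset. Qed.

Lemma card_topI t i : #|` topI t i| = i.
Proof.
rewrite -[RHS](size_iota (t - i).+1); apply: perm_size; apply: uniq_perm.
- exact: fset_uniq.
- exact: iota_uniq.
- by move=> x; rewrite in_topI.
Qed.

Lemma sub_boxP n k (H : hgraph) :
  sub_box n k H <-> {subset H <= ksub (iota 1 n) k}.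
Proof.
have inE' e : in_range n e <-> {subset e <= iota 1 n}.
  split=> he x /he; first by rewrite mem_iota add1n ltnS.
  by rewrite mem_iota add1n ltnS.
split=> sub e eH.
  by have [c /inE' s] := sub e eH; apply/mem_ksub; rewrite ?iota_uniq.
by have /(mem_ksub _ _ (iota_uniq _ _)) [/inE' s c] := sub e eH.
Qed.

Lemma disjoint_topI t i k (g : {fset nat}) x : g \in ksub (iota 1 (t - i)) k ->
  x \in g -> x \notin topI t i.
Proof.
move=> /(mem_ksub _ _ (iota_uniq _ _)) [sub _] /sub.
by rewrite in_topI !mem_iota; lia.
Qed.

Lemma topI_addK t i k (g : {fset nat}) : g \in ksub (iota 1 (t - i)) k ->
  (g `|` topI t i) `\` topI t i = g.
Proof.
move=> gk; apply/fsetP => x; rewrite in_fsetD in_fsetU andb_orr andNb orbF.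
by case: (boolP (x \in g)) => [/(disjoint_topI gk) ->|]; rewrite ?andbF.
Qed.

Lemma card_topI_add t i k (g : {fset nat}) : g \in ksub (iota 1 (t - i)) k ->
  #|` g `|` topI t i| = (k + i)%N.
Proof.
move=> gk; rewrite cardfsU card_topI.
have -> : g `&` topI t i = fset0.
  apply/fsetP => x; rewrite in_fsetI in_fset0; apply/negbTE/negP => /andP[xg].
  by apply/negP; apply: disjoint_topI gk xg.
rewrite cardfs0 subn0.
by have [_ ->] := (mem_ksub _ _ (iota_uniq _ _)).1 gk.
Qed.

Lemma topI_add_ksub t i r (g : {fset nat}) : (i <= r)%N -> (i <= t)%N ->
  g \in ksub (iota 1 (t - i)) (r - i) -> g `|` topI t i \in ksub (iota 1 t) r.
Proof.
move=> ir it gk; apply/(mem_ksub _ _ (iota_uniq _ _)); split; last first.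
  by rewrite (card_topI_add gk) subnK.
have [sub _] := (mem_ksub _ _ (iota_uniq _ _)).1 gk.
move=> x; rewrite in_fsetU in_topI => /orP[/sub|]; rewrite !mem_iota; lia.
Qed.

Lemma prod_topI_add (R : comNzRingType) (w : nat -> R) t i k (g : {fset nat}) :
  g \in ksub (iota 1 (t - i)) k ->
  \prod_(x <- g `|` topI t i) w x =
    (\prod_(x <- iota (t - i).+1 i) w x) * \prod_(x <- g) w x.
Proof.
move=> gk; rewrite mulrC -big_cat /=; apply: perm_big; apply: uniq_perm.
- exact: fset_uniq.
- rewrite cat_uniq fset_uniq iota_uniq andbT /=; apply/hasPn => x xI.
  by apply/negP => xg; have := disjoint_topI gk xg; rewrite in_topI xI.
- by move=> x; rewrite in_fsetU in_topI mem_cat.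
Qed.

Lemma wval_unlink (R : realType) (w : nat -> R) t i r H :
  (i <= r)%N -> (i <= t)%N -> sub_box (t - i) (r - i) H ->
  wval w (unlink t i r H) = (esp w (iota 1 t))`_r -
    (\prod_(x <- iota (t - i).+1 i) w x)
      * ((esp w (iota 1 (t - i)))`_(r - i) - wval w H).
Proof.
move=> ir it /sub_boxP sH.
set B : hgraph := [fset g `|` topI t i | g in ksub (iota 1 (t - i)) (r - i) & g \notin H].
have sB : {subset B <= ksub (iota 1 t) r}.
  by move=> e /imfsetP [g /= /andP[gk _] ->]; apply: topI_add_ksub.
have splitG : (esp w (iota 1 t))`_r = wval w (unlink t i r H) + wval w B.
  rewrite -sum_ksub_prod ?iota_uniq // (bigID (fun e => e \in B)) /= addrC.
  congr (_ + _); rewrite -[LHS]big_filter; apply: perm_big; apply: uniq_perm;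
    rewrite ?filter_uniq ?ksub_uniq ?iota_uniq ?fset_uniq // => e;
    rewrite mem_filter.
    by rewrite /unlink -/B in_fsetD in_fset.
  by case: (boolP (e \in B)) => // /sB ->.
suff HB : wval w B = (\prod_(x <- iota (t - i).+1 i) w x)
      * ((esp w (iota 1 (t - i)))`_(r - i) - wval w H).
  by rewrite splitG HB addrK.
rewrite -sum_ksub_prod ?iota_uniq // (bigID (fun e => e \in H)) /=.
have -> : \sum_(e <- ksub (iota 1 (t - i)) (r - i) | e \in H) \prod_(x <- e) w x = wval w H.
  rewrite -[LHS]big_filter; apply: perm_big; apply: uniq_perm;
    rewrite ?filter_uniq ?ksub_uniq ?iota_uniq ?fset_uniq // => e.
  by rewrite mem_filter; case: (boolP (e \in H)) => // /sH ->.
rewrite addrAC subrr add0r /wval /B big_imfset /=; last first.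
  move=> g g' /andP[gk _] /andP[gk' _] gg'.
  by rewrite -(topI_addK gk) gg' (topI_addK gk').
rewrite mulr_sumr undup_id ?ksub_uniq ?iota_uniq // big_filter.
rewrite big_seq_cond [RHS]big_seq_cond; apply: eq_bigr => g /andP[gk _].
exact: prod_topI_add gk.
Qed.

Lemma unlink_sub_box t i r H : sub_box t r (unlink t i r H).
Proof. by apply/sub_boxP => e; rewrite in_fsetD in_fset => /andP[]. Qed.

Lemma wval1 (R : realType) (G : hgraph) : wval (fun=> 1 : R) G = #|` G|%:R.
Proof.
rewrite /wval; under eq_bigr do rewrite big1_eq.
by rewrite sum_const_seq mulr1.
Qed.

(** Cardinality is the weight under the constant function 1, and there [wval_unlink] sees H only
    through its size. *)
Lemma card_unlink (R : realType) t i r H H' :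
  (i <= r)%N -> (i <= t)%N ->
  sub_box (t - i) (r - i) H -> sub_box (t - i) (r - i) H' ->
  #|` H| = #|` H'| -> #|` unlink t i r H| = #|` unlink t i r H'|.
Proof.
move=> ir it sH sH' HH'; apply/eqP; rewrite -(eqr_nat R) -!wval1.
by rewrite !wval_unlink // !wval1 HH'.
Qed.

Lemma mem_link (G : hgraph) I (e : {fset nat}) :
  e \in link G I <-> exists2 f, f \in G /\ I `<=` f & e = f `\` I.
Proof.
split=> [/imfsetP [f /= /andP[fG If] ->]|[f [fG If] ->]]; first by exists f.
by apply/imfsetP; exists f => //=; rewrite inE /= fG.
Qed.

Lemma link_sub_box t i r (G : hgraph) : (i <= t)%N -> sub_box t r G ->
  sub_box (t - i) (r - i) (link G (topI t i)).
Proof.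
move=> it sG e /mem_link [f [fG If] ->]; have [c rg] := sG f fG.
split; first by rewrite cardfsDS // c card_topI.
move=> x; rewrite in_fsetD in_topI mem_iota => /andP[xI /rg]; lia.
Qed.

Lemma fsetDUK (T : choiceType) (A B : {fset T}) :
  B `<=` A -> (A `\` B) `|` B = A.
Proof. by move=> /fsetUidPl AB; rewrite fsetUDr fsetDv fsetD0. Qed.

Lemma unlink_link t i r (G : hgraph) : (i <= r)%N -> (i <= t)%N ->
  sub_box t r G ->
  (forall e : {fset nat}, #|` e| = r -> in_range t e -> e \notin G ->
     topI t i `<=` e) ->
  unlink t i r (link G (topI t i)) = G.
Proof.
move=> ir it sG full; have /sub_boxP sG' := sG.
apply/fsetP => e; apply/idP/idP.
  rewrite in_fsetD in_fset => /andP[eB ek]; apply/negPn/negP => eG.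
  have [es ec] := (mem_ksub _ _ (iota_uniq _ _)).1 ek.
  have er : in_range t e by move=> x /es; rewrite mem_iota add1n ltnS.
  have Ie := full e ec er eG.
  have eE : (e `\` topI t i) `|` topI t i = e by exact: fsetDUK.
  case/negP: eB; apply/imfsetP; exists (e `\` topI t i); last by rewrite eE.
  rewrite /= inE /=; apply/andP; split.
    apply/(mem_ksub _ _ (iota_uniq _ _)); split; last by rewrite cardfsDS // ec card_topI.
    move=> x; rewrite in_fsetD in_topI => /andP[+ /es]; rewrite !mem_iota; lia.
  apply/negP => /mem_link [f [fG If] ef]; case/negP: eG.
  suff -> : e = f by [].
  by rewrite -eE ef fsetDUK.
move=> eG; rewrite in_fsetD in_fset sG' // andbT.
apply/imfsetP => -[g /= /andP[gk gH] eE]; case/negP: gH; apply/mem_link.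
exists e; last by rewrite eE (topI_addK gk).
by split=> //; rewrite eE fsubsetUr.
Qed.

(** * Second order expansion of the weight *)

Lemma sum_sqr_dev (R : realFieldType) (T : Type) (f : T -> R) s :
  (0 < size s)%N ->
  \sum_(x <- s) (f x - (\sum_(y <- s) f y) / (size s)%:R) ^+ 2 =
  \sum_(x <- s) f x ^+ 2 - (\sum_(x <- s) f x) ^+ 2 / (size s)%:R.
Proof.
move=> s0; set S := \sum_(y <- s) f y; set n : R := (size s)%:R.
have n0 : n != 0 by rewrite pnatr_eq0 -lt0n.
transitivity (\sum_(x <- s) (f x ^+ 2 - 2 * (S / n) * f x + (S / n) ^+ 2)).
  by apply: eq_bigr => x _; ring.
rewrite big_split sumrB /= -mulr_sumr sum_const_seq -/S -/n.
by field.
Qed.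

Lemma sqr_sum_le (R : realFieldType) (T : Type) (f : T -> R) s :
  (\sum_(x <- s) f x) ^+ 2 <= (size s)%:R * \sum_(x <- s) f x ^+ 2.
Proof.
case: s => [|x s]; first by rewrite !big_nil expr0n mulr0.
have n0 : 0 < (size (x :: s))%:R :> R by rewrite ltr0n.
rewrite mulrC -ler_pdivrMr // -subr_ge0 -sum_sqr_dev //.
by rewrite sumr_ge0 // => y _; exact: sqr_ge0.
Qed.

(** Young's inequality. The parameter [c] stays free because it is used at the curvature and at a
    quarter of it. *)
Lemma sum_amgm (R : realFieldType) (T : Type) (f h : T -> R) s (c : R) : 0 < c ->
  \sum_(x <- s) f x * h x <=
    (\sum_(x <- s) f x ^+ 2) / (2 * c) + c / 2 * \sum_(x <- s) h x ^+ 2.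
Proof.
move=> c0; rewrite mulr_suml mulr_sumr -big_split /= ler_sum // => x _.
rewrite -subr_ge0.
have -> : f x ^+ 2 / (2 * c) + c / 2 * h x ^+ 2 - f x * h x =
  (f x - c * h x) ^+ 2 / (2 * c) by field; rewrite gt_eqF.
by rewrite divr_ge0 ?sqr_ge0 // mulr_ge0 ?ltW.
Qed.

Lemma prod1D_le_expR (R : realType) (T : eqType) (w : T -> R) s :
  (forall x, x \in s -> 0 <= w x) ->
  \prod_(x <- s) (1 + w x) <= expR (\sum_(x <- s) w x).
Proof.
elim: s => [|x s IH] w0; first by rewrite !big_nil expR0.
rewrite !big_cons expRD ler_pM ?expR_ge1Dx //.
- by rewrite addr_ge0 // w0 ?mem_head.
- rewrite big_seq prodr_ge0 // => y ys.
  by rewrite addr_ge0 // w0 // in_cons ys orbT.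
- by rewrite IH // => y ys; rewrite w0 // in_cons ys orbT.
Qed.

(* Generating polynomial of the subsets of the top [i] vertices, without the
   full set: it carries the part of the weight that does not depend on [H]. *)
Definition top_poly (R : comNzRingType) (w : nat -> R) n i : {poly R} :=
  esp w (iota n.+1 i) - (\prod_(x <- iota n.+1 i) w x) *: 'X^i.

Lemma coef_top_poly_ge (R : realFieldType) (w : nat -> R) n i j : (0 < i)%N ->
  (forall x, x \in iota n.+1 i -> 0 <= w x) ->
  (j == 0)%:R <= (top_poly w n i)`_j.
Proof.
move=> i0 w0; rewrite coefB coefZ coefXn.
have [->|ji] := eqVneq j i.
  have := coef_esp_size w (iota n.+1 i); rewrite size_iota => ->.
  by rewrite mulr1 subrr gtn_eqF.
rewrite mulr0 subr0; case: j ji => [|j] _; first by rewrite coef_esp0.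
exact: coef_esp_ge0.
Qed.

Lemma top_poly_le_esp (R : realFieldType) (w : nat -> R) n i :
  (forall x, x \in iota n.+1 i -> 0 <= w x) ->
  (top_poly w n i).[1] <= \prod_(x <- iota n.+1 i) (1 + w x).
Proof.
move=> w0; rewrite hornerD hornerN hornerZ hornerXn expr1n mulr1 /esp.
rewrite horner_prod lerBlDr -[leLHS]addr0 lerD //; last first.
  by rewrite big_seq prodr_ge0.
rewrite le_eqVlt; apply/orP; left; apply/eqP; apply: eq_bigr => x _.
by rewrite hornerD hornerC hornerZ hornerX mulr1.
Qed.

(** All coefficients are nonnegative, so each is at most the value at 1, a product of factors 1 +
    weight; this is at most the exponential of the total weight, a bound free of n. *)
Lemma coef_top_poly_bound (R : realType) (w : nat -> R) (a : R) n i l m :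
  (0 < i)%N -> (l <= n)%N ->
  (forall x, x \in iota n.+1 i -> 0 <= w x) -> 0 <= a ->
  n%:R * a + \sum_(x <- iota n.+1 i) w x = 1 ->
  `|(top_poly w n i * (1 + a *: 'X) ^+ l)`_m| <= expR 1 /\
  `|(1 * (1 + a *: 'X) ^+ l : {poly R})`_m| <= expR 1.
Proof.
move=> i0 ln w0 a0 S1.
have L0 j : 0 <= ((1 + a *: 'X) ^+ l : {poly R})`_j.
  by rewrite coef_linear_exp mulr_ge0 ?ler0n ?exprn_ge0.
have P0 j : 0 <= (top_poly w n i)`_j.
  by apply: le_trans (coef_top_poly_ge j i0 w0); rewrite ler0n.
have L1 : ((1 + a *: 'X) ^+ l : {poly R}).[1] <= expR (n%:R * a).
  rewrite horner_exp hornerD hornerC hornerZ hornerX mulr1.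
  rewrite (@le_trans _ _ (expR a ^+ l)) //.
    by rewrite lerXn2r ?nnegrE ?addr_ge0 ?expR_ge0 // expR_ge1Dx.
  by rewrite -expRM_natl ler_expR ler_wpM2r // ler_nat.
have P1 : (top_poly w n i).[1] <= expR (\sum_(x <- iota n.+1 i) w x).
  exact: le_trans (top_poly_le_esp w0) (prod1D_le_expR w0).
have hor0 (p : {poly R}) : (forall j, 0 <= p`_j) -> 0 <= p.[1].
  by move=> p0; apply: le_trans (p0 0%N) (coef_le_horner1 0 p0).
split.
  rewrite ger0_norm ?coef_mul_ge0 //.
  apply: (le_trans (coef_le_horner1 _ _)) => [j|]; first exact: coef_mul_ge0.
  have -> : expR 1 = expR (\sum_(x <- iota n.+1 i) w x) * expR (n%:R * a).
    by rewrite -expRD addrC S1.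
  by rewrite hornerM ler_pM ?hor0.
rewrite mul1r ger0_norm //; apply: (le_trans (coef_le_horner1 _ L0)).
apply: (le_trans L1); by rewrite ler_expR -[leRHS]S1 lerDl big_seq sumr_ge0.
Qed.

(** Only the constant term of [top_poly], at least 1, is kept. The rest is C(n-2, m) a^m, and (n-2)
    a / 2 >= n a / 4 >= 1/8. *)
Lemma coef_top_poly_low (R : realType) (w : nat -> R) (a : R) n i m :
  (0 < i)%N -> (forall x, x \in iota n.+1 i -> 0 <= w x) -> 0 <= a ->
  2^-1 <= n%:R * a -> (m.*2 + 4 <= n)%N ->
  8^-1 ^+ m / m`!%:R <= (top_poly w n i * (1 + a *: 'X) ^+ (n - 2))`_m.
Proof.
move=> i0 w0 a0 na mn.
apply: (@le_trans _ _ ((1 + a *: 'X) ^+ (n - 2) : {poly R})`_m); last first.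
  rewrite coefM big_ord_recl subn0 /= -[leLHS]addr0 lerD //.
    rewrite ler_peMl ?(coef_top_poly_ge 0 i0 w0) //.
    by rewrite coef_linear_exp mulr_ge0 ?ler0n ?exprn_ge0.
  rewrite sumr_ge0 // => j _; rewrite mulr_ge0 //.
    by apply: le_trans (coef_top_poly_ge _ i0 w0); rewrite ler0n.
  by rewrite coef_linear_exp mulr_ge0 ?ler0n ?exprn_ge0.
rewrite coef_linear_exp.
apply: (@le_trans _ _ (((n - 2)%:R / 2) ^+ m / m`!%:R * a ^+ m)); last first.
  by rewrite ler_wpM2r ?exprn_ge0 // bin_ge //; lia.
rewrite mulrAC -exprMn ler_wpM2r ?invr_ge0 ?ler0n // lerXn2r ?nnegrE //.
- by rewrite mulr_ge0 // divr_ge0 ?ler0n.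
have n2 : n%:R / 2 <= (n - 2)%:R :> R.
  by rewrite ler_pdivrMr ?ltr0n // -natrM ler_nat; lia.
have : n%:R / 2 * a <= (n - 2)%:R * a by rewrite ler_wpM2r.
by nra.
Qed.

Lemma wval_unlink_top (R : realType) (w : nat -> R) n i k (H : hgraph) :
  sub_box n k H ->
  wval w (unlink (n + i) i (i + k) H) =
    (top_poly w n i * esp w (iota 1 n))`_(i + k)
    + (\prod_(x <- iota n.+1 i) w x) * wval w H.
Proof.
move=> sH; rewrite wval_unlink ?leq_addr ?leq_addl ?addnK ?addKn //.
rewrite iotaD add1n {1}/esp big_cat /= -!/(esp _ _) mulrBl coefB.
rewrite -scalerAl coefZ mulrC [in RHS]coefXnM ltnNge leq_addr /= addKn.
by ring.
Qed.

(** The weight when all vertices of [n] have weight [a]; the link enters only through its number of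
    edges [h]. *)
Definition base_value (R : comNzRingType) (w : nat -> R) n i k (a : R) (h : nat) : R :=
  (top_poly w n i * (1 + a *: 'X) ^+ n)`_(i + k.+2)
  + (\prod_(x <- iota n.+1 i) w x) * (h%:R * a ^+ k.+2).

(** The coefficient c of [-|eps|^2 / 2], taken from the part of the weight that does not involve
    H. *)
Definition curvature (R : comNzRingType) (w : nat -> R) n i k (a : R) : R :=
  (top_poly w n i * (1 + a *: 'X) ^+ (n - 2))`_(i + k).

(** [esp_perturb] expands the part independent of H to second order, [wval_shift] expands w(H) to
    first order. The second-order part of w(H) goes into the error, where it carries the small
    factor n * beta. *)
Lemma wval_expansion (R : realType) (w eps : nat -> R) (a N : R) n i k (H : hgraph) :
  let beta := \prod_(x <- iota n.+1 i) w x in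
  (0 < i)%N -> (0 < n)%N -> sub_box n k.+2 H ->
  (forall x, x \in iota n.+1 i -> 0 <= w x) -> 0 <= a ->
  n%:R * a + \sum_(x <- iota n.+1 i) w x = 1 ->
  (forall x, x \in iota 1 n -> w x = a + eps x) ->
  \sum_(x <- iota 1 n) eps x = 0 ->
  \sum_(x <- iota 1 n) eps x ^+ 2 = N ^+ 2 -> 0 <= N -> n%:R * N ^+ 2 <= 1 ->
  `|wval w (unlink (n + i) i (i + k.+2) H)
    - (base_value w n i k a #|` H|
       + beta * a ^+ k.+1 * (\sum_(x <- iota 1 n) (deg H x)%:R * eps x)
       - curvature w n i k a / 2 * N ^+ 2)|
  <= ((i + k)%:R * expR 1 * N + k.+1%:R * expR 1 * (n%:R * beta)) * N ^+ 2.
Proof.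
move=> beta i0 n0 sH w0 a0 S1 wE S0 SN N0 nN; rewrite wval_unlink_top //.
have sH' := (sub_boxP _ _ _).1 sH.
have beta0 : 0 <= beta by rewrite /beta big_seq prodr_ge0.
have N1 : N <= 1.
  rewrite -(@ler_pXn2r _ 2) ?nnegrE // expr1n (le_trans _ nN) //.
  by rewrite ler_peMl ?sqr_ge0 // ler1n.
have -> : esp w (iota 1 n) = esp (fun x => a + eps x) (iota 1 n).
  by apply: eq_big_seq => x /wE ->.
have -> : wval w H = wval (fun x => a + eps x) H.
  apply: eq_big_seq => e /sH' /(mem_ksub _ _ (iota_uniq _ _)) [es _].
  by apply: eq_big_seq => x /es /wE ->.
pose S : R := \sum_(x <- iota 1 n) `|eps x|.
(* Cauchy-Schwarz; this is where the factor n in n * beta comes from. *)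
have S2 : S ^+ 2 <= n%:R * N ^+ 2.
  rewrite -SN; have := sqr_sum_le (fun x => `|eps x|) (iota 1 n).
  rewrite size_iota; under [X in _ * X]eq_bigr do rewrite real_normK ?num_real //.
  by [].
have S1' : S <= 1.
  rewrite -(@ler_pXn2r _ 2) ?nnegrE // ?sumr_ge0 // expr1n.
  exact: le_trans nN.
have bound j m := @coef_top_poly_bound R w a n i (n - j) m i0 (leq_subr j n) w0 a0 S1.
have B1 := @esp_perturb R _ (top_poly w n i) eps (iota 1 n) a (i + k) N (expR 1) N0 N1 S0 SN.
have B2 := @wval_shift R H eps a (iota 1 n) k (expR 1) (iota_uniq _ _) sH' a0 S1'.
rewrite size_iota in B1 B2.
have {}B1 := B1 (fun j _ => (bound j _).1).
have {}B2 := B2 (fun j _ => (bound j _).2).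
rewrite -/S in B2; rewrite (@sum_deg _ eps _ (iota 1 n)) ?iota_uniq // in B2; last first.
  by move=> e /sH' /(mem_ksub _ _ (iota_uniq _ _)) [es _].
have {}B2 : beta * `|wval (fun x => a + eps x) H - #|` H|%:R * a ^+ k.+2
     - a ^+ k.+1 * \sum_(x <- iota 1 n) (deg H x)%:R * eps x|
  <= k.+1%:R * expR 1 * (n%:R * beta) * N ^+ 2.
  apply: (le_trans (ler_wpM2l beta0 B2)).
  have -> : k.+1%:R * expR 1 * (n%:R * beta) * N ^+ 2 =
    beta * (k.+1%:R * expR 1 * (n%:R * N ^+ 2)) by ring.
  by rewrite ler_wpM2l // ler_wpM2l // mulr_ge0 ?expR_ge0 ?ler0n.
rewrite -{1}(ger0_norm beta0) -normrM in B2.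
rewrite -!addnS in B1; move: B1 B2; rewrite /base_value /curvature -/beta.
set A1 := (_ * esp _ _)`_(_).
set A2 := (top_poly w n i * (1 + a *: 'X) ^+ n)`_(_).
set A3 := (top_poly w n i * (1 + a *: 'X) ^+ (n - 2))`_(_).
set W := wval _ _; set D := \sum_(x <- _) _; set X := _ - _ => B1.
set Y := beta * (W - _ - _) => B2.
have -> : A1 + beta * W - (A2 + beta * (#|` H|%:R * a ^+ k.+2)
  + beta * a ^+ k.+1 * D - A3 / 2 * N ^+ 2) = X + Y by rewrite /X /Y; ring.
apply: (le_trans (ler_normD _ _)); rewrite [leRHS]mulrDl lerD //.
by rewrite -mulrA -exprS.
Qed.

(** * Optimising a quadratic with a small error *)

(** Here [X] is the linear term and V = g^2 Q(H). The first bound on [X] gives the maximum V / (2c).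
    The second shows that F > b forces N = O(nu), which makes the error O(nu V); for F <= b nothing
    is left to prove. *)
Lemma quadratic_upper (R : realFieldType) (c kappa V N A B nu F b X : R) :
  0 < kappa -> kappa <= c -> 0 <= V -> V <= nu ^+ 2 -> 0 <= N -> 0 <= nu ->
  0 <= A -> 0 <= B -> A * N <= kappa / 8 -> B * nu <= kappa / 8 ->
  X <= V / (2 * c) + c / 2 * N ^+ 2 -> X <= 2 * V / c + c / 8 * N ^+ 2 ->
  F <= b + X - c / 2 * N ^+ 2 + (A * N + B * nu) * N ^+ 2 ->
  F <= b + V / (2 * c) + (4 * A / kappa + B) * (16 / kappa ^+ 2) * nu * V.
Proof.
move=> k0 kc V0 Vnu N0 nu0 A0 B0 AN Bn X1 X2 FX.
have c0 : 0 < c by apply: lt_le_trans kc.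
have C0 : 0 <= (4 * A / kappa + B) * (16 / kappa ^+ 2) * nu * V.
  by rewrite !mulr_ge0 ?addr_ge0 ?mulr_ge0 ?invr_ge0 ?exprn_ge0 // ltW.
have Vc0 : 0 <= V / (2 * c) by rewrite divr_ge0 // mulr_ge0 // ltW.
have [Fb|bF] := leP F b; first by lra.
have N2 : 0 <= N ^+ 2 by apply: sqr_ge0.
(* The error uses up at most half of the quadratic term [c / 2 * N ^+ 2]. *)
have muN : (A * N + B * nu) * N ^+ 2 <= c / 4 * N ^+ 2.
  by rewrite ler_wpM2r //; lra.
have Nle : N ^+ 2 <= 16 / kappa ^+ 2 * V.
  have h1 : c / 8 * N ^+ 2 <= 2 * V / c by lra.
  have h2 : N ^+ 2 <= 16 / c ^+ 2 * V.
    have -> : 16 / c ^+ 2 * V = (2 * V / c) / (c / 8) by field; rewrite gt_eqF.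
    by rewrite ler_pdivlMr ?divr_gt0 // mulrC.
  apply: (le_trans h2); rewrite ler_wpM2r // ler_wpM2l //.
  by rewrite lef_pV2 ?posrE ?exprn_gt0 // lerXn2r ?nnegrE // ltW.
have Nnu : N <= 4 * nu / kappa.
  rewrite -(@ler_pXn2r _ 2) ?nnegrE ?divr_ge0 ?mulr_ge0 ?(ltW k0) //.
  apply: (le_trans Nle).
  have -> : (4 * nu / kappa) ^+ 2 = 16 / kappa ^+ 2 * nu ^+ 2.
    by field; rewrite gt_eqF.
  by rewrite ler_wpM2l // divr_ge0 ?exprn_ge0 // ltW.
have : (A * N + B * nu) * N ^+ 2 <=
    (4 * A / kappa + B) * (16 / kappa ^+ 2) * nu * V; last by lra.
have -> : (4 * A / kappa + B) * (16 / kappa ^+ 2) * nu * V =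
   (A * (4 * nu / kappa) + B * nu) * (16 / kappa ^+ 2 * V).
  by field; rewrite gt_eqF.
rewrite ler_pM ?addr_ge0 ?mulr_ge0 //.
by rewrite lerD // ler_wpM2l.
Qed.

(** The same estimate at the maximiser of the quadratic, with the error constant of
    [quadratic_upper] so that the two bounds can be subtracted. *)
Lemma quadratic_lower (R : realFieldType) (c kappa V N A B nu F b X : R) :
  0 < kappa -> kappa <= c -> 0 <= V -> V <= nu ^+ 2 -> 0 <= N -> 0 <= nu ->
  0 <= A -> 0 <= B -> N ^+ 2 = V / c ^+ 2 -> X = V / c ->
  b + X - c / 2 * N ^+ 2 - (A * N + B * nu) * N ^+ 2 <= F ->
  b + V / (2 * c) - (4 * A / kappa + B) * (16 / kappa ^+ 2) * nu * V <= F.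
Proof.
move=> k0 kc V0 Vnu N0 nu0 A0 B0 NE XE; apply: le_trans.
have c0 : 0 < c by apply: lt_le_trans kc.
have -> : b + X - c / 2 * N ^+ 2 = b + V / (2 * c).
  by rewrite NE XE; field; rewrite gt_eqF.
rewrite lerD2l lerN2.
have Nle : N ^+ 2 <= kappa ^- 2 * V.
  rewrite NE mulrC ler_wpM2r // lef_pV2 ?posrE ?exprn_gt0 //.
  by rewrite lerXn2r ?nnegrE // ltW.
have k2 : 0 <= kappa ^- 2 by rewrite invr_ge0 exprn_ge0 // ltW.
have Nnu : N <= nu / kappa.
  rewrite -(@ler_pXn2r _ 2) ?nnegrE ?divr_ge0 ?(ltW k0) //.
  by apply: (le_trans Nle); rewrite expr_div_n mulrC ler_wpM2r.
have kn : 0 <= nu / kappa by rewrite divr_ge0 // ltW.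
have -> : (4 * A / kappa + B) * (16 / kappa ^+ 2) * nu * V =
   (A * (4 * (nu / kappa)) + B * nu) * (16 * (kappa ^- 2 * V)).
  by field; rewrite gt_eqF.
rewrite ler_pM ?addr_ge0 ?mulr_ge0 ?sqr_ge0 //.
  by rewrite lerD // ler_wpM2l //; lra.
by apply: (le_trans Nle); rewrite ler_peMl ?mulr_ge0 // ler1n.
Qed.

(** * Degree deviations and the gain from exchanging links *)

Definition deg_dev (R : fieldType) (H : hgraph) n (x : nat) : R :=
  (deg H x)%:R - (\sum_(y <- iota 1 n) (deg H y)%:R) / n%:R.

Lemma sum_deg_const (R : pzRingType) (H : hgraph) n k : sub_box n k H ->
  \sum_(x <- iota 1 n) (deg H x)%:R = (#|` H| * k)%:R :> R.
Proof.
move=> /sub_boxP sH.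
transitivity (\sum_(x <- iota 1 n) (deg H x)%:R * (1 : R)).
  by apply: eq_bigr => x _; rewrite mulr1.
rewrite -(@sum_deg R (fun=> 1) H) ?iota_uniq //; last first.
  by move=> e /sH /(mem_ksub _ _ (iota_uniq _ _)) [].
transitivity (\sum_(e <- H) (k%:R : R)); last by rewrite sum_const_seq -natrM.
apply: eq_big_seq => e /sH /(mem_ksub _ _ (iota_uniq _ _)) [_ ek].
by rewrite sum_const_seq mulr1 -ek.
Qed.

Lemma sum_deg_dev (R : realFieldType) (H : hgraph) n : (0 < n)%N ->
  \sum_(x <- iota 1 n) deg_dev R H n x = 0.
Proof.
move=> n0; rewrite sumrB sum_const_seq size_iota mulrCA divff ?mulr1 ?subrr //.
by rewrite pnatr_eq0 -lt0n.
Qed.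

(** This is Q(H). For a fixed number of edges it differs from P_2 by a constant, so comparing Q
    compares P_2. *)
Lemma sum_deg_dev2 (R : realFieldType) (H : hgraph) n k : (0 < n)%N ->
  sub_box n k H -> \sum_(x <- iota 1 n) deg_dev R H n x ^+ 2 =
    (P2 H)%:R - (#|` H| * k)%:R ^+ 2 / n%:R.
Proof.
move=> n0 sH; rewrite (@P2E _ _ (iota 1 n)) ?iota_uniq //; last first.
  by move/sub_boxP: sH => sH e /sH /(mem_ksub _ _ (iota_uniq _ _)) [].
rewrite -(sum_deg_const R sH).
have := @sum_sqr_dev R _ (fun x => (deg H x)%:R) (iota 1 n).
by rewrite size_iota => ->.
Qed.

Lemma deg_dev_le (R : realFieldType) (H : hgraph) n k x : (0 < n)%N ->
  sub_box n k.+1 H -> `|deg_dev R H n x| <= n%:R ^+ k.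
Proof.
move=> n0 /sub_boxP sH.
have le_deg y : (deg H y)%:R <= n%:R ^+ k :> R.
  by rewrite -natrX ler_nat; have := deg_le y (iota_uniq _ _) sH; rewrite size_iota.
have n0' : 0 < n%:R :> R by rewrite ltr0n.
have m0 : 0 <= (\sum_(y <- iota 1 n) (deg H y)%:R) / n%:R :> R.
  by rewrite divr_ge0 ?ler0n // sumr_ge0 // => y _; rewrite ler0n.
have m1 : (\sum_(y <- iota 1 n) (deg H y)%:R) / n%:R <= n%:R ^+ k :> R.
  rewrite ler_pdivrMr // mulrC -[X in X%:R * _](size_iota 1 n) -sum_const_seq.
  by rewrite ler_sum.
have := le_deg x; have : 0 <= (deg H x)%:R :> R by rewrite ler0n.
by rewrite /deg_dev ler_norml; lra.
Qed.

Lemma sum_deg_dev2_le (R : realFieldType) (H : hgraph) n k : (0 < n)%N ->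
  sub_box n k.+1 H ->
  \sum_(x <- iota 1 n) deg_dev R H n x ^+ 2 <= n%:R * (n%:R ^+ k) ^+ 2.
Proof.
move=> n0 sH; rewrite -[X in X%:R * _](size_iota 1 n) -sum_const_seq ler_sum // => x _.
rewrite -[leLHS]real_normK ?num_real // lerXn2r ?nnegrE ?exprn_ge0 ?ler0n //.
exact: deg_dev_le.
Qed.

Lemma iota_addl n i x : x \in iota 1 n -> x \in iota 1 (n + i).
Proof. by rewrite !mem_iota; lia. Qed.

Lemma iota_addr n i x : x \in iota n.+1 i -> x \in iota 1 (n + i).
Proof. by rewrite !mem_iota; lia. Qed.

Lemma iota_add_disjoint n i x : x \in iota n.+1 i -> x \notin iota 1 n.
Proof. by rewrite !mem_iota; lia. Qed.

(** From [w] for H a weighting [w'] for H' is built with the same weights on I and the same mean [a]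
    below. Then base, g and c agree, and the upper bound for H is subtracted from the lower bound
    for H'. *)
Lemma gain (R : realType) (w : nat -> R) (a N kappa : R) n i k (H H' : hgraph) :
  let beta := \prod_(x <- iota n.+1 i) w x in
  let c := curvature w n i k a in
  let A : R := (i + k)%:R * expR 1 in
  let B : R := k.+1%:R * expR 1 in
  let K := (4 * A / kappa + B) * (16 / kappa ^+ 2) in
  (0 < i)%N -> (0 < n)%N -> sub_box n k.+2 H -> sub_box n k.+2 H' ->
  #|` H| = #|` H'| ->
  (forall x, x \in iota 1 (n + i) -> 0 <= w x) ->
  \sum_(x <- iota 1 (n + i)) w x = 1 ->
  \sum_(x <- iota 1 n) w x = n%:R * a ->
  \sum_(x <- iota 1 n) (w x - a) ^+ 2 = N ^+ 2 -> 0 <= N ->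
  n%:R * N ^+ 2 <= 1 -> 0 < kappa -> kappa <= c -> 2^-1 <= n%:R * a ->
  A * N <= kappa / 8 -> B * (n%:R * beta) <= kappa / 8 ->
  n%:R * beta <= kappa / 2 ->
  exists w', [/\ forall x, 0 <= w' x, forall x, x \notin iota 1 (n + i) -> w' x = 0,
    \sum_(x <- iota 1 (n + i)) w' x = 1 &
    (beta * a ^+ k.+1) ^+ 2 / (2 * c) * ((P2 H')%:R - (P2 H)%:R
      - 2 * c * K * (n%:R * beta) * ((P2 H)%:R + (P2 H')%:R)) <=
    wval w' (unlink (n + i) i (i + k.+2) H')
    - wval w (unlink (n + i) i (i + k.+2) H)].
Proof.
move=> beta c A B K i0 n0 sH sH' HH' w0 sw swJ SN N0 nN k0 kc na AN Bnu nuk.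
have n0' : 0 < n%:R :> R by rewrite ltr0n.
have iJ x : x \in iota 1 n -> x \in iota 1 (n + i)  by exact: iota_addl.
have iI x : x \in iota n.+1 i -> x \in iota 1 (n + i) by exact: iota_addr.
have w0I x : x \in iota n.+1 i -> 0 <= w x by move=> /iI /w0.
have sIJ (f : nat -> R) : \sum_(x <- iota 1 (n + i)) f x =
    \sum_(x <- iota 1 n) f x + \sum_(x <- iota n.+1 i) f x.
  by rewrite iotaD add1n big_cat.
have a0 : 0 <= a by rewrite -(pmulr_rge0 _ n0') (le_trans _ na).
have S1 : n%:R * a + \sum_(x <- iota n.+1 i) w x = 1 by rewrite -swJ -sIJ.
have na1 : n%:R * a <= 1 by rewrite -[leRHS]S1 lerDl big_seq sumr_ge0.
have beta0 : 0 <= beta by rewrite /beta big_seq prodr_ge0.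
have c0 : 0 < c by apply: lt_le_trans kc.
have A0 : 0 <= A by rewrite mulr_ge0 ?expR_ge0.
have B0 : 0 <= B by rewrite mulr_ge0 ?expR_ge0.
pose nu := n%:R * beta; have nu0 : 0 <= nu by rewrite mulr_ge0.
pose g := beta * a ^+ k.+1; have g0 : 0 <= g by rewrite mulr_ge0 ?exprn_ge0.
(* The left side is [beta * (n a)^(k+1)] with n a <= 1. *)
have gn : g * n%:R ^+ k.+1 <= beta.
  by rewrite -mulrA -exprMn [a * _]mulrC ler_piMr // exprn_ile1 // mulr_ge0.
pose Q (X : hgraph) : R := \sum_(x <- iota 1 n) deg_dev R X n x ^+ 2.
have Q0 X : 0 <= Q X by rewrite sumr_ge0 // => x _; exact: sqr_ge0.
have ngQ X : sub_box n k.+2 X -> n%:R * (g ^+ 2 * Q X) <= nu ^+ 2.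
  move=> sX; have -> : nu ^+ 2 = n%:R * (n%:R * beta ^+ 2) by rewrite /nu; ring.
  rewrite ler_wpM2l //.
  apply: (@le_trans _ _ (n%:R * (g * n%:R ^+ k.+1) ^+ 2)).
    have -> : n%:R * (g * n%:R ^+ k.+1) ^+ 2 = g ^+ 2 * (n%:R * (n%:R ^+ k.+1) ^+ 2).
      by ring.
    by rewrite ler_wpM2l ?sqr_ge0 // sum_deg_dev2_le.
  by rewrite ler_wpM2l // lerXn2r ?nnegrE // mulr_ge0 // exprn_ge0.
have gQ X : sub_box n k.+2 X -> g ^+ 2 * Q X <= nu ^+ 2.
  move=> /ngQ; apply: le_trans; rewrite ler_peMl ?ler1n //.
  by rewrite mulr_ge0 ?sqr_ge0.
have dE X (eps : nat -> R) : \sum_(x <- iota 1 n) eps x = 0 ->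
    \sum_(x <- iota 1 n) (deg X x)%:R * eps x =
    \sum_(x <- iota 1 n) deg_dev R X n x * eps x.
  move=> e0; under [RHS]eq_bigr do rewrite mulrBl.
  by rewrite sumrB -[X in _ - X]mulr_sumr e0 mulr0 subr0.
have up : wval w (unlink (n + i) i (i + k.+2) H) <=
    base_value w n i k a #|` H| + g ^+ 2 * Q H / (2 * c) + K * nu * (g ^+ 2 * Q H).
  have e0 : \sum_(x <- iota 1 n) (w x - a) = 0.
    by rewrite sumrB swJ sum_const_seq size_iota subrr.
  have := @wval_expansion R w (fun x => w x - a) a N n i k H i0 n0 sH w0I a0 S1.
  move=> /(_ (fun x _ => esym (subrKC _ _)) e0 SN N0 nN); rewrite dE //.
  rewrite -/beta -/g -/c -/nu -/A -/B.
  set Y := \sum_(x <- _) _; rewrite ler_distl => /andP[_ Fle].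
  apply: (@quadratic_upper _ c kappa _ N A B nu _ _ (g * Y)) => //.
  - by rewrite mulr_ge0 ?sqr_ge0.
  - exact: gQ.
  - have := @sum_amgm R _ (fun x => g * deg_dev R H n x) (fun x => w x - a) (iota 1 n) c c0.
    rewrite SN /Q mulr_sumr /Y mulr_sumr.
    under eq_bigr do rewrite -mulrA.
    by under [X in _ <= X / _ + _ -> _]eq_bigr do rewrite exprMn.
  (* Weight c/4 leaves most of the negative quadratic term, as [quadratic_upper] requires to bound
     N. *)
  - have := @sum_amgm R _ (fun x => g * deg_dev R H n x) (fun x => w x - a) (iota 1 n) (c / 4).
    rewrite SN /Q mulr_sumr /Y mulr_sumr => /(_ (divr_gt0 c0 (ltr0n _ 4))).
    under eq_bigr do rewrite -mulrA.
    under [X in _ <= X / _ + _ -> _]eq_bigr do rewrite exprMn.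
    set V := \sum_(x <- _) _ ^+ 2 * _.
    have -> : V / (2 * (c / 4)) + c / 4 / 2 * N ^+ 2 = 2 * V / c + c / 8 * N ^+ 2.
      by field; rewrite gt_eqF.
    by [].
(* The maximiser of [g * <deg_dev, eps> - c/2 |eps|^2]. *)
pose eps' x := g / c * deg_dev R H' n x.
pose w' x := if x \in iota 1 n then a + eps' x
             else if x \in iota n.+1 i then w x else 0.
have wI x : x \in iota n.+1 i -> w' x = w x.
  by move=> xI; rewrite /w' xI ifN //; apply: iota_add_disjoint xI.
have wJ x : x \in iota 1 n -> w' x = a + eps' x by rewrite /w' => ->.
have e0 : \sum_(x <- iota 1 n) eps' x = 0 by rewrite -mulr_sumr sum_deg_dev ?mulr0.
pose N' := g / c * Num.sqrt (Q H').
have N'0 : 0 <= N' by rewrite mulr_ge0 ?sqrtr_ge0 // divr_ge0 // ltW.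
have N'E : N' ^+ 2 = g ^+ 2 * Q H' / c ^+ 2.
  by rewrite /N' exprMn sqr_sqrtr // expr_div_n mulrAC.
have SN' : \sum_(x <- iota 1 n) eps' x ^+ 2 = N' ^+ 2.
  rewrite N'E /Q mulrAC -expr_div_n mulr_sumr; apply: eq_bigr => x _.
  by rewrite exprMn.
have nuk' : nu <= kappa by rewrite (le_trans nuk) // ler_pdivrMr // ler_peMr ?ler1n // ltW.
exists w'; split.
- move=> x; rewrite /w'; case: ifP => [xJ|_]; last first.
    by case: ifP => // /w0I.
  (* Nonnegativity of [w']: the deviation is at most beta / c, and n * beta <= kappa / 2 with n a >=
     1/2 gives beta <= a * kappa <= a * c. *)
  have : `|eps' x| <= a; last by rewrite ler_norml; lra.
  rewrite normrM ger0_norm ?divr_ge0 ?(ltW c0) //.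
  apply: (@le_trans _ _ (g / c * n%:R ^+ k.+1)).
    by rewrite ler_wpM2l ?divr_ge0 ?(ltW c0) // deg_dev_le.
  rewrite mulrAC ler_pdivrMr //; apply: (le_trans gn).
  apply: (@le_trans _ _ (a * kappa)); last by rewrite ler_wpM2l.
  rewrite -(ler_pM2l n0') (le_trans nuk) // [leRHS]mulrA mulrC.
  by rewrite ler_wpM2r ?(ltW k0).
- move=> x xN; rewrite /w' !ifN //; first by apply: contra xN => /iI.
  by apply: contra xN => /iJ.
- rewrite sIJ (eq_big_seq _ wJ) (eq_big_seq _ wI) big_split /= e0 addr0.
  by rewrite sum_const_seq size_iota.
have tp : top_poly w' n i = top_poly w n i.
  rewrite /top_poly (eq_big_seq _ wI) /esp; congr (_ - _).
  by apply: eq_big_seq => x /wI ->.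
have bE : \prod_(x <- iota n.+1 i) w' x = beta by rewrite (eq_big_seq _ wI).
have lo : base_value w n i k a #|` H| + g ^+ 2 * Q H' / (2 * c)
    - K * nu * (g ^+ 2 * Q H') <= wval w' (unlink (n + i) i (i + k.+2) H').
  have w0I' x : x \in iota n.+1 i -> 0 <= w' x by move=> xI; rewrite wI ?w0I.
  have S1' : n%:R * a + \sum_(x <- iota n.+1 i) w' x = 1 by rewrite (eq_big_seq _ wI).
  have nN' : n%:R * N' ^+ 2 <= 1.
    rewrite N'E mulrA ler_pdivrMr ?exprn_gt0 // mul1r (le_trans (ngQ _ sH')) //.
    by rewrite lerXn2r ?nnegrE ?(ltW c0) // (le_trans nuk').
  have := @wval_expansion R w' eps' a N' n i k H' i0 n0 sH' w0I' a0 S1' wJ e0 SN' N'0 nN'.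
  rewrite dE // /base_value /curvature tp bE -HH' -/(base_value _ _ _ _ _ _).
  rewrite -/(curvature _ _ _ _ _) -/beta -/g -/c -/nu -/A -/B.
  set Y := \sum_(x <- _) _; rewrite ler_distl => /andP[leF _].
  apply: (@quadratic_lower _ c kappa _ N' A B nu _ _ (g * Y)) => //.
  - by rewrite mulr_ge0 ?sqr_ge0.
  - exact: gQ.
  - have -> : Y = g / c * Q H'.
      by rewrite /Y /Q mulr_sumr; apply: eq_bigr => x _; rewrite /eps'; ring.
    by field; rewrite gt_eqF.
(* Turns the errors, proportional to Q, into errors proportional to P_2. *)
have KQ X : sub_box n k.+2 X -> Q X <= (P2 X)%:R.
  by move=> sX; rewrite /Q (sum_deg_dev2 _ n0 sX) gerBl divr_ge0 ?sqr_ge0.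
have QQ : Q H' - Q H = (P2 H')%:R - (P2 H)%:R.
  by rewrite /Q (sum_deg_dev2 _ n0 sH) (sum_deg_dev2 _ n0 sH') HH'; ring.
have K0 : 0 <= K.
  by rewrite mulr_ge0 ?addr_ge0 ?divr_ge0 ?mulr_ge0 ?exprn_ge0 // ltW.
have Kg : 0 <= K * nu * g ^+ 2 by rewrite mulr_ge0 ?sqr_ge0 // mulr_ge0.
have := ler_wpM2l Kg (lerD (KQ _ sH) (KQ _ sH')).
have -> : g ^+ 2 / (2 * c) * ((P2 H')%:R - (P2 H)%:R
      - 2 * c * K * nu * ((P2 H)%:R + (P2 H')%:R)) =
  g ^+ 2 * Q H' / (2 * c) - g ^+ 2 * Q H / (2 * c)
  - K * nu * g ^+ 2 * ((P2 H)%:R + (P2 H')%:R).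
  by rewrite -QQ; field; rewrite gt_eqF.
by move: up lo; lra.
Qed.

(** * Near-optimal weightings *)

(** By [finite_weightingW] and [finite_weighting_above] the Lagrangian of a graph on [t] is decided
    by these weightings, so series can be left behind. *)
Definition finite_weighting (R : realType) (t : nat) (w : nat -> R) : Prop :=
  [/\ forall x, 0 <= w x, forall x, x \notin iota 1 t -> w x = 0 &
      \sum_(x <- iota 1 t) w x = 1].

Lemma sum_iota1 (R : nmodType) (w : nat -> R) t :
  \sum_(0 <= x < t.+1) w x = w 0 + \sum_(x <- iota 1 t) w x.
Proof. by rewrite big_ltn // /index_iota subn1. Qed.

Lemma finite_weightingW (R : realType) t (w : nat -> R) :
  finite_weighting t w -> weighting w.
Proof.
case=> w0 wN S1; split=> //.
have w00 : w 0%N = 0 by apply: wN; rewrite mem_iota.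
apply: (@cvg_near_cst _ _ (1 : R)); exists t.+1 => // n /= tn; rewrite /series /=.
rewrite (big_cat_nat _ tn) //= sum_iota1 w00 add0r S1 big_nat_cond big1 ?addr0 //.
by move=> x /andP[/andP[tx _] _]; rewrite wN // mem_iota; lia.
Qed.

Lemma weighting_sum_le (R : realType) t (w : nat -> R) :
  weighting w -> \sum_(x <- iota 1 t) w x <= 1.
Proof.
case=> w0 cw; have nd : nondecreasing_seq (series w).
  by apply/nondecreasing_seqP => n; rewrite /series /= big_nat_recr //= lerDl.
have := nondecreasing_cvgn_le nd (cvgP _ cw) t.+1.
rewrite (cvg_lim _ cw) // /series /= sum_iota1; apply: le_trans.
by rewrite lerDr.
Qed.

Lemma wval_le_mono (R : realType) (w w' : nat -> R) t r (G : hgraph) :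
  sub_box t r G -> (forall x, 0 <= w x) ->
  (forall x, x \in iota 1 t -> w x <= w' x) -> wval w G <= wval w' G.
Proof.
move=> /sub_boxP sG w0 ww'; rewrite /wval !big_seq ler_sum // => e /sG.
move=> /(mem_ksub _ _ (iota_uniq _ _)) [es _].
by rewrite !big_seq ler_prod // => x /es xt; rewrite w0 ww'.
Qed.

Lemma finite_weighting_above (R : realType) t r (G : hgraph) (w : nat -> R) :
  (0 < t)%N -> sub_box t r G -> weighting w ->
  exists2 w', finite_weighting t w' & wval w G <= wval w' G.
Proof.
move=> t0 sG ww; have S1 := weighting_sum_le t ww; case: ww => w0 _.
set S := \sum_(x <- _) _ in S1.
(* The mass outside [t] moves to vertex 1, so no weight inside [t] decreases. *)
pose w' x := if x \in iota 1 t then w x + (x == 1%N)%:R * (1 - S) else 0.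
have e0 x : 0 <= (x == 1%N)%:R * (1 - S) by rewrite mulr_ge0 ?subr_ge0.
exists w'; last first.
  by apply: (wval_le_mono sG w0) => x xt; rewrite /w' xt lerDl.
split.
- by move=> x; rewrite /w'; case: ifP => // _; rewrite addr_ge0.
- by move=> x /negbTE xt; rewrite /w' xt.
- transitivity (\sum_(x <- iota 1 t) (w x + (x == 1%N)%:R * (1 - S))).
    by apply: eq_big_seq => x xt; rewrite /w' xt.
  rewrite big_split /= -/S -mulr_suml.
  suff -> : \sum_(x <- iota 1 t) (x == 1%N)%:R = 1 :> R by rewrite mul1r; lra.
  case: t t0 {sG S w' e0 S1} => // t _; rewrite /= big_cons eqxx big_seq big1 ?addr0 //.
  by move=> x; rewrite mem_iota; case: x => [|[|x]].
Qed.

Lemma wval_le_esp (R : realType) (w : nat -> R) t r (G : hgraph) :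
  sub_box t r G -> (forall x, 0 <= w x) -> wval w G <= (esp w (iota 1 t))`_r.
Proof.
move=> /sub_boxP sG w0; rewrite -sum_ksub_prod ?iota_uniq //.
by apply: sum_fset_ksub; rewrite ?iota_uniq // => e _; rewrite prodr_ge0.
Qed.

Lemma wval_le1 (R : realType) (w : nat -> R) t r (G : hgraph) :
  sub_box t r G -> finite_weighting t w -> wval w G <= 1.
Proof.
move=> sG [w0 _ S1]; apply: (le_trans (wval_le_esp sG w0)).
by rewrite (le_trans (coef_esp_le_pow _ _)) // S1 expr1n.
Qed.

Definition uniform_weighting (R : realType) (t x : nat) : R :=
  if x \in iota 1 t then t%:R^-1 else 0.

Lemma uniform_weightingP (R : realType) t : (0 < t)%N ->
  finite_weighting t (@uniform_weighting R t).
Proof.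
move=> t0; split=> [x|x /negbTE xt|]; rewrite /uniform_weighting ?xt //.
  by case: ifP => // _; rewrite invr_ge0 ler0n.
transitivity (\sum_(x <- iota 1 t) (t%:R^-1 : R)).
  by apply: eq_big_seq => x ->.
by rewrite sum_const_seq size_iota divff // pnatr_eq0 -lt0n.
Qed.

Lemma lagrangian_has_sup (R : realType) t r (G : hgraph) : (0 < t)%N ->
  sub_box t r G ->
  has_sup [set y : R | exists w, weighting w /\ y = wval w G]%classic.
Proof.
move=> t0 sG; split.
  exists (wval (@uniform_weighting R t) G), (@uniform_weighting R t).
  by split=> //; apply: finite_weightingW; apply: uniform_weightingP.
exists 1 => _ [w [ww ->]]; have [w' fw' le] := finite_weighting_above t0 sG ww.
exact: le_trans le (wval_le1 sG fw').
Qed.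

Lemma wval_le_lagrangian (R : realType) t r (G : hgraph) (w : nat -> R) :
  (0 < t)%N -> sub_box t r G -> finite_weighting t w ->
  wval w G <= lagrangian R G.
Proof.
move=> t0 sG fw; apply: sup_upper_bound; first exact: lagrangian_has_sup sG.
by exists w; split=> //; apply: finite_weightingW fw.
Qed.

Lemma lagrangian_near (R : realType) t r (G : hgraph) (d : R) :
  (0 < t)%N -> sub_box t r G -> 0 < d ->
  exists2 w, finite_weighting t w & lagrangian R G - d <= wval w G.
Proof.
move=> t0 sG d0.
have [y [w [ww ->]] lt] := sup_adherent d0 (lagrangian_has_sup R t0 sG).
have [w' fw' le] := finite_weighting_above t0 sG ww.
by exists w' => //; apply: le_trans (ltW lt) le.
Qed.

Lemma esp_const (R : comNzRingType) (w : nat -> R) (a : R) s :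
  (forall x, x \in s -> w x = a) -> esp w s = (1 + a *: 'X) ^+ size s.
Proof.
move=> wa; rewrite /esp (eq_big_seq (fun=> 1 + a *: 'X)) => [|x /wa -> //].
by rewrite big_const_seq count_predT iter_mulr_1.
Qed.

(** At the uniform weighting the missing sets weigh at most t^-i, since all contain I. So a
    near-optimal weighting is within t^-i + d of the Maclaurin bound, and stability applies. *)
Lemma near_optimal_close (R : realType) i k : (0 < i)%N ->
  exists2 C : R, 0 < C & forall n (H : hgraph) (w : nat -> R) (d : R),
    ((i + k.+2).*2 <= n + i)%N -> sub_box n k.+2 H ->
    finite_weighting (n + i) w -> d <= (n + i)%:R ^- i ->
    lagrangian R (unlink (n + i) i (i + k.+2) H) - d <=
      wval w (unlink (n + i) i (i + k.+2) H) ->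
    \sum_(x <- iota 1 (n + i)) (w x - (n + i)%:R^-1) ^+ 2 <= C / (n + i)%:R ^+ i.
Proof.
move=> i0; have r3 : (3 <= i + k.+2)%N by lia.
have [c c0 stab] := coef_esp_stability R r3.
(* One t^-i of the 2 pays for the missing sets, the other for [d]. *)
exists (2 / c) => [|n H w d nr sH fw dle near]; first by rewrite divr_gt0.
set t := (n + i)%N in nr fw dle near *; have t0 : (0 < t)%N by lia.
have t0' : 0 < t%:R :> R by rewrite ltr0n.
have sG := @unlink_sub_box t i (i + k.+2) H.
have [w0 _ S1] := fw.
have := stab _ w (iota 1 t); rewrite size_iota => /(_ nr (fun x _ => w0 x) S1) up.
have fu := @uniform_weightingP R t t0.
have lo := wval_le_lagrangian t0 sG fu.
have [u0 uN U1] := fu.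
have uE x : x \in iota 1 t -> uniform_weighting R t x = t%:R^-1.
  by rewrite /uniform_weighting => ->.
have sH' : sub_box (t - i) (i + k.+2 - i) H by rewrite /t addnK addKn.
have := wval_unlink (@uniform_weighting R t) (leq_addr _ _) (leq_addl n i) sH'.
rewrite -/t (esp_const uE) size_iota coef_linear_exp.
have -> : \prod_(x <- iota (t - i).+1 i) uniform_weighting R t x = t%:R ^- i.
  rewrite (eq_big_seq (fun=> t%:R^-1)) => [|x xI]; last first.
    by apply: uE; move: xI; rewrite /t addnK => /iota_addr.
  by rewrite big_const_seq count_predT iter_mulr_1 size_iota exprVn.
have e1 : (esp (uniform_weighting R t) (iota 1 (t - i)))`_(i + k.+2 - i) <= 1.
  rewrite (le_trans (coef_esp_le_pow _ _)) // exprn_ile1 //; first by rewrite sumr_ge0.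
  rewrite -U1 [leRHS](_ : _ = \sum_(x <- iota 1 (t - i)) uniform_weighting R t x
     + \sum_(x <- iota (t - i).+1 i) uniform_weighting R t x).
    by rewrite lerDl sumr_ge0.
  by rewrite -big_cat /= -[(t - i).+1]add1n -iotaD subnK // leq_addl.
have wH0 : 0 <= wval (@uniform_weighting R t) H.
  by rewrite sumr_ge0 // => e _; rewrite prodr_ge0.
set e := (esp _ _)`_(_) in e1 *; set v := wval _ H in wH0 *; move=> Eu.
have ti0 : 0 <= t%:R ^- i :> R by rewrite invr_ge0 exprn_ge0 // ltW.
have ev : t%:R ^- i * (e - v) <= t%:R ^- i :> R by rewrite ler_piMr //; lra.
have leG := wval_le_esp sG w0.
rewrite mulrAC ler_pdivlMr // mulrC.
move: up; rewrite -exprVn => up.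
by move: Eu lo near dle leG up ev; rewrite -?exprVn; lra.
Qed.

Lemma bin_le_addr n k m : ('C(n, k) <= 'C(n + m, k + m))%N.
Proof.
elim: m => [|m IH]; first by rewrite !addn0.
by rewrite !addnS binS (leq_trans IH) // leq_addl.
Qed.

(* Halving one vertex of the uniform weighting on [t - 1] vertices loses
   nothing, and the edges coming from [H] are a strict gain. *)
Lemma lagrangian_gt (R : realType) n i k (H : hgraph) : (2 <= i)%N ->
  sub_box n k.+2 H -> H != fset0 ->
  'C((n + i).-1, i + k.+2)%:R / (n + i).-1%:R ^+ (i + k.+2)
    < lagrangian R (unlink (n + i) i (i + k.+2) H).
Proof.
case: i => [|[|j]] // _ sH H0; set m := (n + j)%N.
have tE : (n + j.+2)%N = m.+2 by rewrite /m !addnS.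
have tE' : (n + j.+2)%N = (m + 2)%N by rewrite tE addn2.
set a : R := m.+1%:R^-1; have a0 : 0 < a by rewrite invr_gt0.
pose v x : R := if x \in iota 1 m then a else if x \in iota m.+1 2 then a / 2 else 0.
have vJ x : x \in iota 1 m -> v x = a by rewrite /v => ->.
have vI x : x \in iota m.+1 2 -> v x = a / 2.
  by move=> xI; rewrite /v xI ifN //; apply: iota_add_disjoint xI.
have v0 x : 0 <= v x.
  by rewrite /v; case: ifP => [_|_]; [exact: ltW | case: ifP => // _; rewrite divr_ge0 ?ltW].
have fv : finite_weighting (n + j.+2) v.
  split=> // [x|]; rewrite tE'.
    by move=> xt; rewrite /v !ifN //; apply: contra xt; [apply: iota_addr|apply: iota_addl].
  rewrite iotaD add1n big_cat (eq_big_seq _ vJ) (eq_big_seq _ vI) /=.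
  rewrite sum_const_seq !big_cons big_nil size_iota.
  have -> : m%:R * a + (a / 2 + (a / 2 + 0)) = (m%:R + 1) * a by field.
  by rewrite natr1 divff.
have t0 : (0 < n + j.+2)%N by rewrite tE.
have sG := @unlink_sub_box (n + j.+2) j.+2 (j.+2 + k.+2) H.
apply: lt_le_trans (wval_le_lagrangian t0 sG fv).
rewrite wval_unlink ?leq_addr ?leq_addl ?addnK ?addKn //.
have -> : \prod_(x <- iota n.+1 j.+2) v x = a ^+ j * (a / 2) ^+ 2.
  rewrite -[j.+2]addn2 iotaD big_cat /= addSn -/m.
  congr (_ * _); last by rewrite (eq_big_seq _ vI) /= !big_cons big_nil mulr1.
  rewrite (eq_big_seq (fun=> a)) => [|x /iota_addr /vJ //].
  by rewrite big_const_seq count_predT size_iota iter_mulr_1.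
have -> : esp v (iota 1 n) = (1 + a *: 'X) ^+ n.
  by rewrite (@esp_const _ v a) ?size_iota // => x /(@iota_addl _ j) /vJ.
have -> : esp v (iota 1 (n + j.+2)) =
    (1 + a *: 'X) ^+ m.+1 + (a / 2) ^+ 2 *: ('X^2 * (1 + a *: 'X) ^+ m).
  rewrite tE' iotaD add1n /esp big_cat /= -!/(esp _ _).
  rewrite (@esp_const _ v a) ?size_iota // (@esp_const _ v (a / 2)) // exprS.
  rewrite scalerAl -mulrDl mulrC; congr (_ * _).
  have aX : a *: 'X = a / 2 *: 'X + a / 2 *: 'X :> {poly R}.
    by rewrite -scalerDl -splitr.
  rewrite -exprZn aX.
  by set Y := a / 2 *: 'X; ring.
rewrite coefD coefZ coefXnM !coef_linear_exp tE -[m.+2.-1]/m.+1.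
rewrite -exprVn -/a [(j.+2 + _)%N]addSn addSn /= subn2 /=.
rewrite -addrA ltrDl.
(* Splitting the vertex gains C(m, j+k+2) sets containing both halves; the missing sets cost at most
   C(n, k+2), which is no larger because m = n + j. *)
have -> : (a / 2) ^+ 2 * ('C(m, j + k.+2)%:R * a ^+ (j + k.+2))
  - a ^+ j * (a / 2) ^+ 2 * ('C(n, k.+2)%:R * a ^+ k.+2 - wval v H) =
  (a / 2) ^+ 2 * a ^+ (j + k.+2) * ('C(m, j + k.+2)%:R - 'C(n, k.+2)%:R)
  + a ^+ j * (a / 2) ^+ 2 * wval v H by rewrite exprD; ring.
have b0 : 0 < a / 2 by rewrite divr_gt0.
apply: ltr_wpDl.
  apply: mulr_ge0; first by rewrite mulr_ge0 ?exprn_ge0 // ltW.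
  by rewrite subr_ge0 ler_nat addnC bin_le_addr.
apply: mulr_gt0; first by rewrite mulr_gt0 // exprn_gt0.
have [e eH] := fset0Pn _ H0.
rewrite /wval (big_fsetD1 e) //=; apply: ltr_pwDl.
  rewrite big_seq prodr_gt0 // => x xe; rewrite vJ //.
  move/sub_boxP: sH => /(_ e eH) /(mem_ksub _ _ (iota_uniq _ _)) [/(_ x xe)].
  by move=> /(@iota_addl _ j).
by rewrite sumr_ge0 // => f _; rewrite prodr_ge0.
Qed.

(** Sets avoiding x obey Maclaurin's bound on t - 1 vertices, and sets through x weigh at most [w x]
    in total. So beating the complete graph on t - 1 vertices forces every weight away from 0. *)
Lemma wval_le_vertex (R : realType) t r (G : hgraph) (w : nat -> R) x :
  sub_box t r.+1 G -> finite_weighting t w -> x \in iota 1 t ->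
  wval w G <= 'C(t.-1, r.+1)%:R / t.-1%:R ^+ r.+1 + w x.
Proof.
move=> sG [w0 _ S1] xt; apply: (le_trans (wval_le_esp sG w0)).
have w0' y : y \in rem x (iota 1 t) -> 0 <= w y by [].
have Srem : \sum_(y <- rem x (iota 1 t)) w y = 1 - w x by rewrite sum_rem ?S1.
have S0 : 0 <= 1 - w x by rewrite -Srem sumr_ge0.
have Sle : 1 - w x <= 1 by rewrite gerBl.
rewrite (coef_esp_rem _ _ xt) lerD //.
  apply: (le_trans (coef_esp_max _ w0')); rewrite size_rem // size_iota Srem.
  rewrite expr_div_n ler_wpM2l ?ler0n // ler_piMl ?exprn_ile1 // ?invr_ge0 ?exprn_ge0.
by rewrite ler_piMr // (le_trans (coef_esp_le_pow _ w0')) // Srem exprn_ile1 //.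
Qed.

Lemma le_of_sqr_dev (R : realFieldType) (w t C : R) : 0 < t ->
  (w - t^-1) ^+ 2 <= C / t ^+ 2 -> w <= (2 + C) / t.
Proof.
move=> t0; rewrite ler_pdivlMr ?exprn_gt0 // ler_pdivlMr //.
have -> : (w - t^-1) ^+ 2 * t ^+ 2 = (w * t - 1) ^+ 2 by field; rewrite gt_eqF.
by move=> h; have := sqr_ge0 (w * t - 3 / 2); nra.
Qed.

Lemma prod_le_const (R : realFieldType) (T : eqType) (w : T -> R) s (c : R) :
  (forall x, x \in s -> 0 <= w x <= c) -> \prod_(x <- s) w x <= c ^+ size s.
Proof.
move=> wc; apply: (@le_trans _ _ (\prod_(x <- s) c)).
  by rewrite !big_seq ler_prod.
by rewrite big_const_seq count_predT iter_mulr_1.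
Qed.

Lemma prod_ge_const (R : realFieldType) (T : eqType) (w : T -> R) s (c : R) :
  0 <= c -> (forall x, x \in s -> c <= w x) -> c ^+ size s <= \prod_(x <- s) w x.
Proof.
move=> c0 wc; apply: (@le_trans _ _ (\prod_(x <- s) c)).
  by rewrite big_const_seq count_predT iter_mulr_1.
by rewrite !big_seq ler_prod // => x xs; rewrite c0 wc.
Qed.

(** * The deficit of P_2 and the theorem *)

(** By contradiction: a larger deficit makes the gain at least [T0 * X0] for every near-optimal
    weighting, with a positive bound independent of the weighting, while near-optimality allows only
    half of it. *)
Lemma P2_deficit (R : realType) i k : (2 <= i)%N ->
  exists C T : R, [/\ 0 <= C, 1 <= T & forall n (H H' : hgraph),
    T <= (n + i)%:R -> sub_box n k.+2 H -> sub_box n k.+2 H' ->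
    #|` H| = #|` H'| -> (P2 H <= P2 H')%N ->
    lagrangian R (unlink (n + i) i (i + k.+2) H') <=
      lagrangian R (unlink (n + i) i (i + k.+2) H) ->
    (P2 H')%:R - (P2 H)%:R <= C / (n + i)%:R ^+ (i - 1) * (P2 H')%:R].
Proof.
move=> i2; have i0 : (0 < i)%N by apply: ltnW.
have [C2 C20 close] := near_optimal_close R k i0.
pose E : R := expR 1; have E0 : 0 < E := expR_gt0 1.
pose Cb := 2 + C2; have Cb0 : 0 < Cb by rewrite addr_gt0.
pose Cn := Cb ^+ i; have Cn0 : 0 < Cn by rewrite exprn_gt0.
pose A : R := (i + k)%:R * E; have A0 : 0 <= A by rewrite mulr_ge0 // ltW.
pose B : R := k.+1%:R * E; have B0 : 0 <= B by rewrite mulr_ge0 // ltW.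
pose kappa : R := 8^-1 ^+ (i + k) / (i + k)`!%:R.
have k0 : 0 < kappa by rewrite divr_gt0 ?exprn_gt0 ?invr_gt0 ?ltr0n ?fact_gt0.
pose K := (4 * A / kappa + B) * (16 / kappa ^+ 2).
have K0 : 0 <= K.
  by rewrite mulr_ge0 ?addr_ge0 ?divr_ge0 ?mulr_ge0 ?exprn_ge0 // ltW.
(* Thresholds for t: [m0] for the size conditions, [T1] for n a >= 1/2, [C2] for n N^2 <= 1, [T2]
   for A N <= kappa/8, [T3] for B nu <= kappa/8 and [T4] for nu <= kappa/2, where nu = n * beta. *)
pose m0 : nat := ((i + k.+2).*2 + (i + k).*2 + 4 + i)%N.
pose T1 := 2 * (i%:R * Cb); have T10 : 0 <= T1 by rewrite !mulr_ge0 // ltW.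
pose T2 := 64 * A ^+ 2 * C2 / kappa ^+ 2.
have T20 : 0 <= T2 by rewrite divr_ge0 ?mulr_ge0 ?exprn_ge0 // ltW.
pose T3 := 8 * B * Cn / kappa.
have T30 : 0 <= T3 by rewrite divr_ge0 ?mulr_ge0 // ltW.
pose T4 := 2 * Cn / kappa; have T40 : 0 <= T4 by rewrite divr_ge0 ?mulr_ge0 // ltW.
have m00 : 0 <= m0%:R :> R by rewrite ler0n.
have C0 : 0 <= 4 * E * K * Cn.
  apply: mulr_ge0 (ltW Cn0); apply: mulr_ge0 K0; exact: mulr_ge0 (ltW E0).
exists (4 * E * K * Cn), (m0%:R + T1 + C2 + T2 + T3 + T4 + 1); split.
- exact: C0.
- by move: m00 T10 C20 T20 T30 T40; clear; lra.
move=> n H H' leT sH sH' HH' leP opt.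
set t := (n + i)%N in leT opt *; set r := (i + k.+2)%N in opt *.
have [mt [T1t [C2t [T2t [T3t [T4t t1]]]]]] : m0%:R <= t%:R :> R /\ T1 <= t%:R /\
    C2 <= t%:R /\ T2 <= t%:R /\ T3 <= t%:R /\ T4 <= t%:R /\ 1 <= t%:R :> R.
  by move: leT m00 T10 C20 T20 T30 T40; clear; lra.
have {}mt : (m0 <= t)%N by rewrite -(ler_nat R).
have [rt kn t0 n0] : [/\ (r.*2 <= t)%N, ((i + k).*2 + 4 <= n)%N,
    (0 < t)%N & (0 < n)%N].
  by split; move: mt i2; rewrite /m0 /t /r; clear; lia.
have t0' : 0 < t%:R :> R by rewrite ltr0n.
have n0' : 0 < n%:R :> R by rewrite ltr0n.
have nt : n%:R <= t%:R :> R by rewrite ler_nat leq_addr.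
pose tau : R := (t%:R ^+ (i - 1))^-1.
have tau0 : 0 < tau by rewrite invr_gt0 exprn_gt0.
set P := (P2 H)%:R; set P' := (P2 H')%:R.
have PP' : P <= P' by rewrite ler_nat.
have P0 : 0 <= P by rewrite ler0n.
rewrite -/tau leNgt; apply/negP => gt.
pose X0 := P' - P - 4 * E * K * Cn * tau * P'.
have X00 : 0 < X0 by rewrite /X0 subr_gt0.
(* The strict inequality [lagrangian_gt] needs an edge in H; an empty H makes H' empty, and then
   [X0] is not positive. *)
have H0 : H != fset0.
  apply/negP => /eqP HE.
  have HE' : H' = fset0 by apply: cardfs0_eq; rewrite -HH' HE cardfs0.
  move: X00; rewrite /X0 /P /P' HE HE' subrr sub0r oppr_gt0 ltNge.
  by rewrite mulr_ge0 ?ler0n // mulr_ge0 ?(ltW tau0).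
set G := unlink t i r H in opt *; set G' := unlink t i r H' in opt *.
have sG : sub_box t r G by apply: unlink_sub_box.
have sG' : sub_box t r G' by apply: unlink_sub_box.
set L : R := 'C(t.-1, r)%:R / t.-1%:R ^+ r.
have Lgt : L < lagrangian R G by apply: lagrangian_gt.
set lam := lagrangian R G in opt Lgt *.
(* Half the excess over the complete graph on t - 1 vertices: with d <= c0, [wval_le_vertex] leaves
   at least [c0] for each weight on I. *)
pose c0 := (lam - L) / 2; have c00 : 0 < c0 by rewrite divr_gt0 // subr_gt0.
(* Lower bound for g^2 / (2c) from beta >= c0^i, a >= 1/(2n) and c <= E; it is fixed before the
   weighting is chosen. *)
pose T0 := (c0 ^+ i * (2 * n%:R)^-1 ^+ k.+1) ^+ 2 / (2 * E).
have T00 : 0 < T0.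
  apply: divr_gt0; last by rewrite mulr_gt0.
  by rewrite exprn_gt0 // mulr_gt0 // exprn_gt0 // invr_gt0 mulr_gt0.
pose d := Num.min (t%:R ^- i) (Num.min c0 (T0 * X0 / 2)).
have TX0 : 0 < T0 * X0 by rewrite mulr_gt0.
have d0 : 0 < d by rewrite !lt_min c00 invr_gt0 exprn_gt0 // divr_gt0.
have d1 : d <= t%:R ^- i by rewrite ge_min lexx.
have d2 : d <= c0 by rewrite !ge_min lexx orbT.
have d3 : d <= T0 * X0 / 2 by rewrite !ge_min lexx !orbT.
have [w fw near] := lagrangian_near t0 sG d0; rewrite -/lam in near.
have [w0 wN S1] := fw.
have dev : \sum_(x <- iota 1 t) (w x - t%:R^-1) ^+ 2 <= C2 / t%:R ^+ 2.
  apply: le_trans (close n H w d rt sH fw d1 near) _.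
  rewrite ler_wpM2l ?(ltW C20) // lef_pV2 ?posrE ?exprn_gt0 //.
  exact: ler_weXn2l.
have wb x : x \in iota 1 t -> w x <= Cb / t%:R.
  move=> xt; apply: le_of_sqr_dev => //; apply: le_trans dev.
  by apply: (@sqr_le_sum_sqr _ _ (fun y => w y - t%:R^-1)).
have wI x : x \in iota n.+1 i -> 0 <= w x <= Cb / t%:R.
  by move=> /iota_addr /wb ->; rewrite w0.
set beta := \prod_(x <- iota n.+1 i) w x.
have beta0 : 0 <= beta by rewrite prodr_ge0.
(* Source of the rate: n <= t and i weights of size at most Cb / t give Cb^i t^-(i-1). *)
have nuT : n%:R * beta <= Cn * tau.
  apply: (@le_trans _ _ (t%:R * (Cb / t%:R) ^+ i)).
    rewrite ler_pM // /beta; have := prod_le_const wI; rewrite size_iota; exact.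
  rewrite expr_div_n /tau -/Cn mulrCA ler_wpM2l ?(ltW Cn0) //.
  by rewrite -[X in _ / _ ^+ X](subnKC i0) exprS invfM mulrA divff ?mul1r ?gt_eqF.
have nut : n%:R * beta <= Cn / t%:R.
  apply: (le_trans nuT); rewrite ler_wpM2l ?(ltW Cn0) // /tau.
  rewrite lef_pV2 ?posrE ?exprn_gt0 // -[leLHS]expr1 ler_weXn2l //.
  by rewrite subn_gt0.
pose a := (\sum_(x <- iota 1 n) w x) / n%:R.
have swJ : \sum_(x <- iota 1 n) w x = n%:R * a by rewrite /a mulrCA divff ?mulr1 ?gt_eqF.
have sIJ : \sum_(x <- iota 1 n) w x + \sum_(x <- iota n.+1 i) w x = 1.
  by rewrite -S1 /t iotaD add1n big_cat.
have na : 2^-1 <= n%:R * a.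
  have SI : \sum_(x <- iota n.+1 i) w x <= i%:R * (Cb / t%:R).
    rewrite -[X in X%:R * _](size_iota n.+1 i) -sum_const_seq !big_seq.
    by apply: ler_sum => x /wI /andP[].
  have : i%:R * (Cb / t%:R) <= 2^-1.
    rewrite mulrA ler_pdivrMr //; move: T1t; rewrite /T1.
    by set u := t%:R; set v := i%:R * Cb; clear; lra.
  by rewrite -swJ; move: SI sIJ; clear; lra.
have a0 : 0 <= a by rewrite divr_ge0 ?sumr_ge0 ?(ltW n0').
pose N := Num.sqrt (\sum_(x <- iota 1 n) (w x - a) ^+ 2).
have N0 : 0 <= N by apply: sqrtr_ge0.
have SN : \sum_(x <- iota 1 n) (w x - a) ^+ 2 = N ^+ 2.
  by rewrite sqr_sqrtr // sumr_ge0 // => x _; apply: sqr_ge0.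
(* The sum of squared deviations is least around the mean [a], so it is at most the one around
   1/t. *)
have N2 : N ^+ 2 <= C2 / t%:R ^+ 2.
  apply: le_trans dev; rewrite -SN /t iotaD add1n big_cat /= -/t.
  apply: (@le_trans _ _ (\sum_(x <- iota 1 n) (w x - t%:R^-1) ^+ 2)); last first.
    by rewrite lerDl sumr_ge0 // => x _; apply: sqr_ge0.
  have := @sum_sqr_dev R _ (fun x => w x - t%:R^-1) (iota 1 n); rewrite size_iota.
  rewrite sumrB sum_const_seq size_iota => /(_ n0) sq.
  rewrite (eq_bigr (fun x => (w x - t%:R^-1 -
    (\sum_(x <- iota 1 n) w x - n%:R / t%:R) / n%:R) ^+ 2)).
    by rewrite sq gerBl divr_ge0 ?sqr_ge0 ?ler0n.
  by move=> x _; rewrite /a; congr (_ ^+ 2); field; rewrite !gt_eqF.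
have nN : n%:R * N ^+ 2 <= 1.
  apply: (@le_trans _ _ (t%:R * (C2 / t%:R ^+ 2))); first by rewrite ler_pM ?sqr_ge0.
  rewrite (_ : t%:R * _ = C2 / t%:R); last by field; rewrite gt_eqF.
  by rewrite ler_pdivrMr // mul1r.
set c := curvature w n i k a.
have S1' : n%:R * a + \sum_(x <- iota n.+1 i) w x = 1 by rewrite -swJ.
have w0I x : x \in iota n.+1 i -> 0 <= w x by [].
have kc : kappa <= c by apply: coef_top_poly_low.
have cE : c <= E.
  have [h _] := coef_top_poly_bound (i + k) i0 (leq_subr 2 n) w0I a0 S1'.
  by apply: le_trans (ler_norm _) h.
have c_gt0 : 0 < c by apply: lt_le_trans kc.
have AN : A * N <= kappa / 8.
  rewrite -(@ler_pXn2r _ 2) ?nnegrE ?(mulr_ge0 A0 N0) ?divr_ge0 ?(ltW k0) //.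
  rewrite exprMn; apply: (@le_trans _ _ (A ^+ 2 * (C2 / t%:R ^+ 2))).
    by rewrite ler_wpM2l ?sqr_ge0.
  rewrite mulrA ler_pdivrMr ?exprn_gt0 //.
  have tt : T2 <= t%:R ^+ 2 by rewrite (le_trans T2t) // expr2 ler_peMl // ltW.
  have := ler_wpM2l (ltW (exprn_gt0 2 k0)) tt.
  have -> : kappa ^+ 2 * T2 = 64 * A ^+ 2 * C2 by rewrite /T2; field; rewrite gt_eqF.
  have -> : (kappa / 8) ^+ 2 = kappa ^+ 2 / 64 by field.
  move: (A ^+ 2) (kappa ^+ 2) (t%:R ^+ 2) => x y z.
  by clear; lra.
have Bnu : B * (n%:R * beta) <= kappa / 8.
  apply: (le_trans (ler_wpM2l B0 nut)); rewrite mulrA ler_pdivrMr //.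
  by move: T3t; rewrite /T3 ler_pdivrMr // ; set u := t%:R; clear; lra.
have nuk : n%:R * beta <= kappa / 2.
  apply: (le_trans nut); rewrite ler_pdivrMr //.
  by move: T4t; rewrite /T4 ler_pdivrMr // ; set u := t%:R; clear; lra.
have [w' [w'0 w'N S1w' ge]] := @gain R w a N kappa n i k H H' i0 n0 sH sH' HH'
  (fun x _ => w0 x) S1 swJ SN N0 nN k0 kc na AN Bnu nuk.
have le' : wval w' G' <= lam.
  by apply: le_trans opt; apply: wval_le_lagrangian sG' _.
have wc x : x \in iota n.+1 i -> c0 <= w x.
  move=> /iota_addr xt; have : wval w G <= L + w x.
    by rewrite /L /r addnS; apply: wval_le_vertex fw xt; rewrite -addnS.
  by move: near d2; rewrite /c0; clear; lra.
have betac : c0 ^+ i <= beta.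
  by have := prod_ge_const (ltW c00) wc; rewrite size_iota.
have ac : (2 * n%:R)^-1 <= a by rewrite invfM -ler_pdivlMr ?invr_gt0 // invrK mulrC.
have Tle : T0 <= (beta * a ^+ k.+1) ^+ 2 / (2 * c).
  have h1 : 0 <= c0 ^+ i by rewrite exprn_ge0 // ltW.
  have h2 : 0 <= (2 * n%:R)^-1 :> R by rewrite invr_ge0 mulr_ge0 // ltW.
  have h3 : (2 * n%:R)^-1 ^+ k.+1 <= a ^+ k.+1 by rewrite lerXn2r ?nnegrE.
  apply: ler_pM.
  - exact: sqr_ge0.
  - by rewrite invr_ge0 mulr_ge0 // ltW.
  - rewrite lerXn2r ?nnegrE //.
    + by apply: mulr_ge0 => //; apply: exprn_ge0.
    + by apply: mulr_ge0 => //; apply: exprn_ge0.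
    + by apply: ler_pM => //; apply: exprn_ge0.
  - by rewrite lef_pV2 ?posrE ?mulr_gt0 // ler_pM2l.
(* From c <= E, n * beta <= Cn * tau and P + P' <= 2 P'; this fixes the constant 4 E K Cn. *)
have Xle : X0 <= P' - P - 2 * c * K * (n%:R * beta) * (P + P').
  rewrite /X0 lerD2l lerN2.
  apply: (@le_trans _ _ (2 * E * K * (Cn * tau) * (P' + P'))); last first.
    by rewrite le_eqVlt; apply/orP; left; apply/eqP; ring.
  have nb0 : 0 <= n%:R * beta by rewrite mulr_ge0 ?ler0n.
  have cK0 : 0 <= 2 * c * K by apply: mulr_ge0 K0; rewrite mulr_ge0 ?(ltW c_gt0).
  apply: ler_pM; [exact: mulr_ge0| |apply: ler_pM => //|by rewrite lerD2r].
    by rewrite addr_ge0 ?ler0n.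
  by rewrite ler_wpM2r // ler_pM2l.
have := le_trans (ler_pM (ltW T00) (ltW X00) Tle Xle) ge; rewrite -/t -/r -/G -/G'.
by move: near d3 le' TX0; clear; lra.
Qed.

Theorem theorem6p1 (R : realType) (r i : nat) :
  (4 <= r)%N -> (2 <= i)%N -> (i <= r - 2)%N ->
  exists C : R, forall (t : nat) (G : hgraph),
    sub_box t r G ->
    (forall G' : hgraph, is_rgraph r G' -> #|` G'| = #|` G| ->
       lagrangian R G' <= lagrangian R G) ->
    left_compressed G ->
    (forall e : {fset nat}, #|` e| = r -> in_range t e -> e \notin G ->
       topI t i `<=` e) ->
    forall M : nat, is_P2max M #|` link G (topI t i)| (r - i) (t - i) ->
    exists eta : R,
      (P2 (link G (topI t i)))%:R = (1 + eta) * M%:R /\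
      `|eta| <= C / (t%:R ^+ (i - 1)).
Proof.
move=> r4 i2 ir.
have [k rE] : exists k, r = (i + k.+2)%N by exists (r - i - 2)%N; lia.
have ir' : (i <= r)%N by rewrite rE leq_addr.
have [C [T [C0 T1 deficit]]] := P2_deficit R k i2.
(* [C] serves t >= T; for t < T the trivial bound |eta| <= 1 is covered by [T ^+ (i - 1)]. *)
exists (C + T ^+ (i - 1)) => t G sG opt _ full M [[H' [sH' [cH' PH']]] maxM].
set H := link G (topI t i) in cH' maxM *.
have T0 : 0 <= T by apply: le_trans T1.
have bound0 : 0 <= (C + T ^+ (i - 1)) / t%:R ^+ (i - 1).
  by rewrite divr_ge0 ?exprn_ge0 ?ler0n // addr_ge0 ?exprn_ge0.
have zero : (P2 H)%:R = 0 :> R -> M%:R = 0 :> R ->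
    exists eta : R, (P2 H)%:R = (1 + eta) * M%:R /\
      `|eta| <= (C + T ^+ (i - 1)) / t%:R ^+ (i - 1).
  by move=> -> ->; exists 0; rewrite mulr0 normr0.
(* For t < i the subtraction t - i truncates to 0; no r-set fits into [t], so all graphs are empty
   and eta = 0 works. *)
have [ti|it] := ltnP t i.
  have P20 : P2 fset0 = 0%N by rewrite /P2 /vertices !big_seq_fset0.
  have G0 : G = fset0.
    apply/eqP; rewrite -[_ == _]negbK; apply/negP => /fset0Pn [e eG].
    have /sub_boxP/(_ e eG) := sG; case/(mem_ksub _ _ (iota_uniq _ _)) => es er.
    have := uniq_leq_size (fset_uniq e) es; rewrite er size_iota.
    by move: ti ir'; clear; lia.
  have H0 : H = fset0.
    apply/fsetP => e; rewrite in_fset0; apply/negP => /mem_link [f [+ _] _].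
    by rewrite G0 in_fset0.
  have H'0 : H' = fset0 by apply: cardfs0_eq; rewrite cH' H0 cardfs0.
  by apply: zero; rewrite -?PH' ?H0 ?H'0 P20.
have sH : sub_box (t - i) (r - i) H by apply: link_sub_box.
have leM : (P2 H <= M)%N by apply: maxM.
have [M0|M0] := posnP M.
  have PH0 : P2 H = 0%N by apply/eqP; rewrite -leqn0 -M0.
  by apply: zero; rewrite ?PH0 ?M0.
have M0' : 0 < M%:R :> R by rewrite ltr0n.
exists ((P2 H)%:R / M%:R - 1); split; first by field; rewrite gt_eqF.
have t0 : 0 < t%:R :> R by rewrite ltr0n (leq_trans _ it) // ltnW.
rewrite distrC ger0_norm; last first.
  by rewrite subr_ge0 ler_pdivrMr // mul1r ler_nat.
have [leT|ltT] := leP T t%:R; last first.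
  apply: (@le_trans _ _ 1); first by rewrite gerBl divr_ge0.
  rewrite ler_pdivlMr ?exprn_gt0 // mul1r (@le_trans _ _ (T ^+ (i - 1))) //.
    by rewrite lerXn2r ?nnegrE ?ler0n // ltW.
  by rewrite lerDr.
have rk : (r - i = k.+2)%N by rewrite rE addKn.
have := deficit (t - i)%N H H'; rewrite subnK // -rE -rk cH' PH'.
move=> /(_ leT sH sH' erefl leM) deficit'.
(* G is recovered from its link, so replacing H by the maximiser H' gives a competitor with the same
   number of edges, to which optimality of G applies. *)
have GE : unlink t i r H = G by apply: unlink_link.
have cG : #|` unlink t i r H'| = #|` G|.
  by rewrite -GE; apply: (card_unlink R).
have rG : is_rgraph r (unlink t i r H').
  by move=> e /(unlink_sub_box (t := t)) [].
have := deficit' _; rewrite GE => /(_ (opt _ rG cG)) le.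
have -> : 1 - (P2 H)%:R / M%:R = (M%:R - (P2 H)%:R) / M%:R :> R.
  by field; rewrite gt_eqF.
rewrite ler_pdivrMr //; apply: (le_trans le); rewrite ler_wpM2r ?(ltW M0') //.
by rewrite ler_wpM2r ?invr_ge0 ?exprn_ge0 ?ler0n // lerDl exprn_ge0.
Qed.
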